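(* Let $R$ be a quasi-fiber product ring. Let $M$ and $N$ be nonzero finitely generated $R$-modules, with $\operatorname{pd}_R N=\infty$. Suppose that (i) $N$ is Tor-rigid; (ii) $\operatorname{Ext}^i_R(M,N)=0$ for all $i$ with $1\le i\le\max\{1,\operatorname{depth}_R N-2\}$; (iii) $\operatorname{Ext}^j_R(M,R)=0$ for every $j$ with $1\le j\le\operatorname{depth} R$. Then $M$ is free.
   Context: All local rings are commutative and Noetherian, and all modules are finitely generated; $\operatorname{pd}$ denotes projective dimension. A local ring $(R,\mathfrak m,k)$ is a fiber product ring if $R\cong S\times_k T=\{(s,t)\in S\times T : \pi_S(s)=\pi_T(t)\}$, where $S,T$ are local rings with the same residue field $k$, neither of them equal to $k$, and $\pi_S,\pi_T$ are the reductions modulo the maximal ideals. Equivalently, $\mathfrak m=I\oplus J$ for nonzero ideals $I,J$ of $R$. A local ring $R$ is a quasi-fiber product ring if there is an $R$-regular sequence $\underline x=x_1,\dots,x_n$ with $n\ge 0$ such that $R/(\underline x)$ is a fiber product ring. An $R$-module $N$ is Tor-rigid if for every $R$-module $Z$ and every $n\ge 1$, $\operatorname{Tor}^R_n(N,Z)=0$ implies $\operatorname{Tor}^R_{n+1}(N,Z)=0$. *)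

(* Defs.v *)
From HB Require Import structures.
From mathcomp Require Import all_boot all_order all_algebra sesquilinear.
From mathcomp Require Import boolp classical_sets.
Set Implicit Arguments.
Unset Strict Implicit.
Unset Printing Implicit Defensive.
Import GRing.Theory.
Local Open Scope classical_set_scope.
Local Open Scope ring_scope.

Definition surjective (A B : Type) (f : A -> B) : Prop :=
  forall y, exists x, f x = y.

Section Ideals.
Variable R : comNzRingType.

Definition ideal (I : set R) : Prop :=
  [/\ I 0, forall x y, I x -> I y -> I (x + y)
    & forall a x, I x -> I (a * x)].

Definition maximal_ideal (m : set R) : Prop :=
  [/\ ideal m, ~ m 1
    & forall I : set R, ideal I -> ~ I 1 -> m `<=` I -> I `<=` m].

(* The submodule (x_1, ..., x_n) M of M, for x = [:: x_1; ...; x_n]; with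
   M = R^o it is the ideal generated by x. *)
Definition seq_smul (M : lmodType R) (x : seq R) : set M :=
  [set u | exists v : nat -> M, u = \sum_(i < size x) x`_i *: v i].

Definition noetherian : Prop :=
  forall I : set R, ideal I -> exists x : seq R, I = seq_smul (M := R^o) x.

Definition noetherian_local (m : set R) : Prop :=
  [/\ noetherian, maximal_ideal m
    & forall m' : set R, maximal_ideal m' -> m' = m].

End Ideals.
Arguments seq_smul {R} M x.


Section RegularSequences.
Variable R : comNzRingType.

Definition regular_sequence (M : lmodType R) (x : seq R) : Prop :=
  (forall i, (i < size x)%N -> forall u : M,
     seq_smul M (take i x) (x`_i *: u) -> seq_smul M (take i x) u) /\
  (exists u : M, ~ seq_smul M x u).

Definition is_depth (m : set R) (M : lmodType R) (n : nat) : Prop :=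
  (exists x : seq R,
     [/\ regular_sequence M x, forall a, a \in x -> m a & size x = n]) /\
  (forall x : seq R,
     regular_sequence M x -> (forall a, a \in x -> m a) -> (size x <= n)%N).

(* The maximal length of an M-regular sequence in m.  It exists when R is
   Noetherian local with maximal ideal m and M is finitely generated and
   nonzero; the default value 0 is used only where no maximum exists. *)
Definition depth (m : set R) (M : lmodType R) : nat :=
  xget 0%N [set n | is_depth m M n].

End RegularSequences.

(* p is the reduction of the ring S modulo its maximal ideal m, onto k. *)
Definition residue_map (S : comNzRingType) (m : set S) (k : fieldType)
    (p : {rmorphism S -> k}) : Prop :=
  surjective p /\ (forall s, p s = 0 <-> m s).

(* The isomorphism of Q with the fiber product S x_k T is given as an injective
   morphism f : Q -> S x T with image {(s, t) | pS s = pT t}.  A local ring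
   differs from its residue field iff its reduction map is not injective. *)
Definition fiber_product_ring (Q : comNzRingType) : Prop :=
  exists (S T : comNzRingType) (mS : set S) (mT : set T) (k : fieldType)
         (pS : {rmorphism S -> k}) (pT : {rmorphism T -> k})
         (f : {rmorphism Q -> (S * T)%type}),
    [/\ noetherian_local mS /\ noetherian_local mT,
        residue_map mS pS /\ residue_map mT pT,
        ~ injective pS /\ ~ injective pT,
        injective f
      & forall s t, pS s = pT t <-> exists q, f q = (s, t)].

(* The quotient R/(x) is presented as a surjection q : R -> Q with kernel (x). *)
Definition quasi_fiber_product_ring (R : comNzRingType) : Prop :=
  exists x : seq R, regular_sequence R^o x /\
  exists (Q : comNzRingType) (q : {rmorphism R -> Q}),
    [/\ surjective q, forall r, q r = 0 <-> seq_smul R^o x r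
      & fiber_product_ring Q].

Section Modules.
Variable R : comNzRingType.

Definition finitely_generated (M : lmodType R) : Prop :=
  exists g : seq M, forall u, exists c : nat -> R,
    u = \sum_(i < size g) c i *: g`_i.

(* Free of finite rank, which for finitely generated modules is the same as
   free. *)
Definition free_module (M : lmodType R) : Prop :=
  exists (n : nat) (f : {linear 'rV[R]_n -> M}), bijective f.

Definition projective (P : lmodType R) : Prop :=
  forall (A B : lmodType R) (g : {linear A -> B}) (f : {linear P -> B}),
    surjective g -> exists h : {linear P -> A}, forall x, g (h x) = f x.

Record proj_resolution (M : lmodType R) := ProjResolution {
  res_obj :> nat -> lmodType R;
  res_diff : forall i, {linear res_obj i.+1 -> res_obj i};
  res_aug : {linear res_obj 0 -> M};
  res_projective : forall i, projective (res_obj i);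
  res_aug_surj : surjective res_aug;
  res_exact0 : forall x,
    res_aug x = 0 <-> exists y, res_diff 0 y = x;
  res_exact : forall i x,
    res_diff i x = 0 <-> exists y, res_diff i.+1 y = x }.

Definition pd_le (M : lmodType R) (n : nat) : Prop :=
  exists P : proj_resolution M,
    forall i, (n < i)%N -> forall x : P i, x = 0.

Definition pd_infinite (M : lmodType R) : Prop := forall n, ~ pd_le M n.

Section Ext.
Variables (M N : lmodType R) (P : proj_resolution M).

Definition is_cocycle (i : nat) (f : {linear P i -> N}) : Prop :=
  forall x, f (res_diff P i x) = 0.

Definition is_coboundary (i : nat) : {linear P i -> N} -> Prop :=
  match i with
  | 0 => fun f => forall x, f x = 0
  | j.+1 => fun f =>
      exists g : {linear P j -> N}, forall x, f x = g (res_diff P j x)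
  end.

End Ext.

(* Ext^i_R(M, N) = 0: exactness at Hom(P_i, N) for the projective resolutions
   P of M. *)
Definition Ext_vanishes (i : nat) (M N : lmodType R) : Prop :=
  forall (P : proj_resolution M) (f : {linear P i -> N}),
    is_cocycle f -> is_coboundary f.

(* Elements of A (x) B are represented by formal sums of pairs, the list
   [:: (a_1, b_1); ...; (a_n, b_n)] standing for a_1 (x) b_1 + ... +
   a_n (x) b_n.  By the universal property, two formal sums are equal in
   A (x) B iff every bilinear map takes the same value on them. *)
Definition tensor_eq (A B : lmodType R) (s t : seq (A * B)) : Prop :=
  forall (C : lmodType R) (phi : {bilinear A -> B -> C}),
    \sum_(p <- s) phi p.1 p.2 = \sum_(p <- t) phi p.1 p.2.

(* f (x) id_B *)
Definition tensor_map (A A' B : lmodType R) (f : A -> A') (s : seq (A * B)) :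
    seq (A' * B) :=
  [seq (f p.1, p.2) | p <- s].

Section Tor.
Variables (N Z : lmodType R) (P : proj_resolution N).

Definition is_cycle (i : nat) : seq (P i * Z) -> Prop :=
  match i with
  | 0 => fun _ => True
  | j.+1 => fun s => tensor_eq (tensor_map (res_diff P j) s) [::]
  end.

Definition is_boundary (i : nat) (s : seq (P i * Z)) : Prop :=
  exists t : seq (P i.+1 * Z), tensor_eq (tensor_map (res_diff P i) t) s.

End Tor.

(* Tor_i^R(N, Z) = 0: exactness at P_i (x) Z for the projective resolutions P
   of N. *)
Definition Tor_vanishes (i : nat) (N Z : lmodType R) : Prop :=
  forall (P : proj_resolution N) (s : seq (P i * Z)),
    is_cycle s -> is_boundary s.

Definition Tor_rigid (N : lmodType R) : Prop :=
  forall Z : lmodType R, finitely_generated Z ->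
  forall n, (1 <= n)%N -> Tor_vanishes n N Z -> Tor_vanishes n.+1 N Z.

End Modules.

(* Main.v *)
Require Import Defs.
From HB Require Import structures.
From mathcomp Require Import all_boot all_order all_algebra sesquilinear.
From mathcomp Require Import boolp classical_sets.
Import GRing.Theory.
Set Implicit Arguments.
Unset Strict Implicit.
Unset Printing Implicit Defensive.
Local Open Scope quotient_scope.
Local Open Scope classical_set_scope.
Local Open Scope ring_scope.

(* Ext^1(M, N) = 0 makes Tor_1(N, X) vanish for X = Tr Omega M, so by rigidity
   Tor_i(N, X) = 0 for all i >= 1.  Call a module small if its Tor against N vanishes in high degrees;
   among the modules of a short exact sequence, any two being small makes the
   third small, and direct summands of small modules are small.  The residue
   field k is not small, since pd N is infinite.

   Let (x) be the regular sequence of length n such that R / (x) is a fiber product,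
   with maximal ideal I + J, I and J nonzero and I J = 0.  A second syzygy K over
   R / (x) of the form { c : c Phi = 0 }, Phi with entries in the maximal ideal, is
   the direct sum of its parts in I and in J.  If K is small and nonzero, one part is
   small and nonzero, say the one in I; it is killed by J, so J^b is a direct
   summand of its first syzygy and J is small.  In the same way J being small gives
   that I is small, hence so is k, a contradiction.  As an n-th syzygy L over R is
   (x)-regular, L / (x) L is small when L is, and therefore the (n+2)-nd minimal
   syzygy of a small module is 0.  A nonzero socle element z of R / (x) kills the
   image of a minimal syzygy, so the cover of L / (x) L over R / (x) has a nonzero
   kernel as soon as L is nonzero; then already the (n+1)-st minimal syzygy is 0.

   Applied to R / (y) for a regular sequence y, this gives depth R <= n + 1, and
   R / (x) has a nonzero socle if depth R = n.  Finally the dual of the minimal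
   resolution of M is, by the vanishing of Ext^j(M, R), the beginning of a minimal
   resolution of a small module; its (depth R + 1)-st syzygy is the image of the
   transpose of the presentation matrix of M, which is thus 0. *)

(** * Linear maps, submodules and quotient modules *)

Lemma linear_of_fun (R : comNzRingType) (A B : lmodType R) (f : A -> B) :
  linear f -> exists g : {linear A -> B}, forall x, g x = f x.
Proof.
move=> fL; pose L := GRing.isLinear.Build R A B *:%R f fL.
by exists (HB.pack_for {linear A -> B} f L).
Qed.

Lemma bilinear_of_fun (R : comNzRingType) (A B C : lmodType R) (f : A -> B -> C) :
  (forall b, linear (f^~ b)) -> (forall a, linear (f a)) ->
  exists g : {bilinear A -> B -> C}, forall a b, g a b = f a b.
Proof.
move=> fL1 fL2.
pose L := bilinear_isBilinear.Build R A B C *:%R *:%R f (pair fL1 fL2).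
by exists (HB.pack_for {bilinear A -> B -> C} f L).
Qed.

Section Submodules.
Variable R : comNzRingType.
Implicit Types M V : lmodType R.

Definition submod M (U : set M) : Prop :=
  [/\ U 0, forall x y, U x -> U y -> U (x + y) & forall a x, U x -> U (a *: x)].

Lemma submodN M (U : set M) x : submod U -> U x -> U (- x).
Proof. by case=> _ _ UZ Ux; rewrite -scaleN1r; apply: UZ. Qed.

Lemma submodB M (U : set M) x y : submod U -> U x -> U y -> U (x - y).
Proof. by move=> sU Ux Uy; case: (sU) => _ UD _; apply: UD => //; apply: submodN. Qed.

Lemma submodBC M (U : set M) x y : submod U -> U (x - y) -> U (y - x).
Proof. by move=> sU Uxy; rewrite -opprB; apply: submodN. Qed.

Lemma submod_addr M (U : set M) x y : submod U -> U y -> U (x + y) -> U x.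
Proof. by move=> sU Uy Uxy; rewrite -(addrK y x); apply: submodB. Qed.

Lemma submod_subr M (U : set M) x y : submod U -> U y -> U (x - y) -> U x.
Proof. by move=> [_ UD _] Uy Uxy; rewrite -(subrK y x); apply: UD. Qed.

Lemma submod_sum M (U : set M) (I : Type) (r : seq I) (P : pred I) (F : I -> M) :
  submod U -> (forall i, P i -> U (F i)) -> U (\sum_(i <- r | P i) F i).
Proof. by case=> U0 UD _ UF; apply: (big_ind U). Qed.

Lemma submodT M : submod (@setT M).
Proof. by []. Qed.

Lemma submod0 M : submod ([set 0] : set M).
Proof. by split=> // [x y -> ->|a x ->]; rewrite ?addr0 ?scaler0. Qed.

Lemma submodI M (U V : set M) : submod U -> submod V -> submod (U `&` V).
Proof.
move=> [U0 UD UZ] [V0 VD VZ]; split=> // [x y [? ?] [? ?]|a x [? ?]].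
  by split; [apply: UD|apply: VD].
by split; [apply: UZ|apply: VZ].
Qed.

Definition submod_sumset M (U V : set M) : set M :=
  [set w | exists u v, [/\ U u, V v & w = u + v]].

Lemma submod_preim M M' (f : {linear M -> M'}) (U : set M') :
  submod U -> submod [set x | U (f x)].
Proof.
move=> [U0 UD UZ]; split=> [|x y Ux Uy|a x Ux] /=.
- by rewrite linear0.
- by rewrite linearD; apply: UD.
- by rewrite linearZ; apply: UZ.
Qed.

End Submodules.

Section Quotient.
Variables (R : comNzRingType) (V : lmodType R) (U : set V) (sU : submod U).

Definition quot_rel (x y : V) : bool := `[< U (x - y) >].

Fact quot_rel_equiv : equiv_class_of quot_rel.
Proof.
split=> [x|x y|y x z].
- by apply/asboolP; rewrite subrr; case: sU.
- by apply/asboolP/asboolP; apply: submodBC.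
- move=> /asboolP Uxy /asboolP Uyz; apply/asboolP.
  by rewrite -(subrKA y) ; case: sU => _ UD _; apply: UD.
Qed.

Canonical quot_equiv := EquivRelPack quot_rel_equiv.
Definition quot_mod := {eq_quot quot_equiv}.
HB.instance Definition _ := Choice.on quot_mod.
HB.instance Definition _ := EqQuotient.on quot_mod.

Let qpi : V -> quot_mod := \pi_quot_mod.

Let qpiE x y : (qpi x = qpi y) <-> U (x - y).
Proof.
split; last by move=> Uxy; apply/eqquotP/asboolP.
by move/eqquotP/asboolP.
Qed.

Let qreprK x : qpi (repr x) = x. Proof. exact: reprK. Qed.

Let qadd (x y : quot_mod) : quot_mod := qpi (repr x + repr y).
Let qopp (x : quot_mod) : quot_mod := qpi (- repr x).
Let qscale a (x : quot_mod) : quot_mod := qpi (a *: repr x).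

Let qaddE x y : qadd (qpi x) (qpi y) = qpi (x + y).
Proof.
apply/qpiE; rewrite opprD addrACA; case: (sU) => _ UD _.
by apply: UD; apply/qpiE; rewrite qreprK.
Qed.

Let qoppE x : qopp (qpi x) = qpi (- x).
Proof. by apply/qpiE; rewrite -opprD; apply/(submodN sU)/qpiE; rewrite qreprK. Qed.

Let qscaleE a x : qscale a (qpi x) = qpi (a *: x).
Proof.
by apply/qpiE; rewrite -scalerBr; case: (sU) => _ _; apply; apply/qpiE; rewrite qreprK.
Qed.

Let qaddA : associative qadd.
Proof.
by move=> x y z; rewrite -(qreprK x) -(qreprK y) -(qreprK z) !qaddE addrA.
Qed.
Let qaddC : commutative qadd.
Proof. by move=> x y; rewrite -(qreprK x) -(qreprK y) !qaddE addrC. Qed.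
Let qadd0 : left_id (qpi 0) qadd.
Proof. by move=> x; rewrite -(qreprK x) !qaddE add0r. Qed.
Let qaddN : left_inverse (qpi 0) qopp qadd.
Proof. by move=> x; rewrite -(qreprK x) qoppE !qaddE addNr. Qed.

HB.instance Definition _ := GRing.isZmodule.Build quot_mod qaddA qaddC qadd0 qaddN.

Let qpiD x y : qpi (x + y) = qpi x + qpi y. Proof. by rewrite -qaddE. Qed.

Let qscaleA a b v : qscale a (qscale b v) = qscale (a * b) v.
Proof. by rewrite -(qreprK v) !qscaleE scalerA. Qed.
Let qscale1 : left_id 1 qscale.
Proof. by move=> v; rewrite -(qreprK v) !qscaleE scale1r. Qed.
Let qscaleDr : right_distributive qscale +%R.
Proof. by move=> a u v; rewrite -(qreprK u) -(qreprK v) -qpiD !qscaleE scalerDr qpiD. Qed.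
Let qscaleDl v : {morph qscale^~ v : a b / a + b}.
Proof. by move=> a b; rewrite -(qreprK v) !qscaleE scalerDl qpiD. Qed.

HB.instance Definition _ :=
  GRing.Zmodule_isLmodule.Build R quot_mod qscaleA qscale1 qscaleDr qscaleDl.

Lemma quotient_module : exists (X : lmodType R) (pi : {linear V -> X}),
  surjective pi /\ forall v, pi v = 0 <-> U v.
Proof.
have qL : linear (qpi : V -> quot_mod) by move=> a x y; rewrite qpiD -qscaleE.
have [pi piE] := linear_of_fun qL.
exists quot_mod, pi; split=> [y|v]; first by exists (repr y); rewrite piE qreprK.
rewrite -(linear0 pi) !piE; split=> [/qpiE|Uv]; first by rewrite subr0.
by apply/qpiE; rewrite subr0.
Qed.

End Quotient.

(** * Noetherian rings: maximal ideals in a family, units, submodules of R^p *)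

Section Noetherian.
Variable R : comNzRingType.

Lemma seq_smul_nth (x : seq R) i : (i < size x)%N -> seq_smul R^o x x`_i.
Proof.
move=> ix; exists (fun j => if j == i then 1 else 0).
rewrite (bigD1 (Ordinal ix)) //= eqxx big1 ?addr0; first by rewrite /GRing.scale /= mulr1.
by move=> j; rewrite -val_eqE /= => /negPf ->; rewrite scaler0.
Qed.

Hypothesis noethR : noetherian R.

(** Otherwise choice gives a strictly increasing chain in [F]. Its union is a finitely generated
    ideal, so one term contains all generators and the next term cannot be larger. *)
Lemma noetherian_maximal (F : set (set R)) (I0 : set R) :
  (forall I, F I -> ideal I) -> F I0 ->
  exists I, F I /\ forall J, F J -> I `<=` J -> J `<=` I.
Proof.
move=> Fid FI0; apply: contrapT => nomax.
have step (I : {I | F I}) : exists J : {J | F J},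
    sval I `<=` sval J /\ ~ (sval J `<=` sval I).
  apply: contrapT => nJ; apply: nomax; exists (sval I); split; first exact: svalP.
  by move=> J FJ IJ; apply: contrapT => nJI; apply: nJ; exists (exist _ J FJ).
have [next nextP] := choice step.
pose C n := iter n next (exist _ I0 FI0).
have CS n k : sval (C n) `<=` sval (C (k + n)%N).
  by elim: k => // k IHk x /IHk; apply: (nextP _).1.
have Cle a b : (a <= b)%N -> sval (C a) `<=` sval (C b).
  by move=> /subnK <-; apply: CS.
have idC n : ideal (sval (C n)) by apply: Fid; apply: svalP.
have idU : ideal [set x | exists n, sval (C n) x].
  split=> [|x y [a Cx] [b Cy]|c x [a Cx]].
  - by exists 0%N; case: (idC 0%N).
  - exists (maxn a b); case: (idC (maxn a b)) => _ CD _.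
    by apply: CD; [apply: Cle Cx; apply: leq_maxl|apply: Cle Cy; apply: leq_maxr].
  - by exists a; case: (idC a) => _ _; apply.
have [x Ux] := noethR idU.
have xU i : (i < size x)%N -> exists n, sval (C n) x`_i.
  move=> ix; suff : [set x | exists n, sval (C n) x] x`_i by [].
  by rewrite Ux; apply: seq_smul_nth.
have [n xn] : exists n, forall i, (i < size x)%N -> sval (C n) x`_i.
  elim: (size x) xU => [|k IHk] xU; first by exists 0%N.
  have [|n xn] := IHk; first by move=> i ik; apply: xU; apply: ltnW.
  have [n' xn'] := xU k (ltnSn k).
  exists (maxn n n') => i; rewrite ltnS leq_eqVlt => /predU1P[->|ik].
    by apply: Cle xn'; apply: leq_maxr.
  by apply: Cle (xn _ ik); apply: leq_maxl.
have [_ []] := nextP (C n) => y Cy.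
have : seq_smul R^o x y by rewrite -Ux; exists n.+1.
case=> v ->; apply: (submod_sum (M := R^o)) => [|i _]; first exact: idC.
by rewrite /GRing.scale /= mulrC; case: (idC n) => _ _; apply; apply: xn.
Qed.

(** For a non-unit [r], an ideal maximal among the proper ideals containing [r] is a maximal ideal,
    hence equals [m], which then contains [r]. *)
Lemma local_unit (m : set R) r : noetherian_local m -> ~ m r -> exists r', r' * r = 1.
Proof.
move=> [_ maxm uniqm] nmr; apply: contrapT => nr.
pose F := [set I : set R | [/\ ideal I, ~ I 1 & I r]].
have [||I [[idI nI1 Ir] Imax]] := @noetherian_maximal F [set x | exists a, x = a * r].
- by move=> I [].
- split=> [|[a a1]|]; last by exists 1; rewrite mul1r.
  + split=> [|_ _ [a ->] [b ->]|c _ [a ->]]; first by exists 0; rewrite mul0r.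
      by exists (a + b); rewrite mulrDl.
    by exists (c * a); rewrite mulrA.
  + by apply: nr; exists a.
- apply: nmr; rewrite -(uniqm I) //; split=> // J idJ nJ1 IJ.
  by apply: Imax => //; split=> //; apply: IJ.
Qed.

Definition lc (M : lmodType R) b (g : 'I_b -> M) (c : 'rV[R]_b) : M :=
  \sum_i c 0 i *: g i.

Fact lc_is_linear (M : lmodType R) b (g : 'I_b -> M) : linear (lc g).
Proof.
move=> a x y; rewrite /lc scaler_sumr -big_split; apply: eq_bigr => i _ /=.
by rewrite !mxE scalerDl scalerA.
Qed.
HB.instance Definition _ (M : lmodType R) b (g : 'I_b -> M) :=
  GRing.isLinear.Build R 'rV[R]_b M *:%R (lc g) (lc_is_linear g).

Lemma lc_delta (M : lmodType R) b (g : 'I_b -> M) i : lc g (delta_mx 0 i) = g i.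
Proof.
rewrite /lc (bigD1 i) //= mxE !eqxx scale1r big1 ?addr0 // => j ji.
by rewrite mxE eqxx (negPf ji) scale0r.
Qed.

Lemma linear_lc (M M' : lmodType R) b (g : 'I_b -> M) (f : {linear M -> M'}) c :
  f (lc g c) = lc (f \o g) c.
Proof. by rewrite /lc linear_sum; apply: eq_bigr => i _; rewrite linearZ. Qed.

Lemma lc_row b p (D : 'M[R]_(b, p)) c : lc (fun i => row i D) c = c *m D.
Proof. by rewrite mulmx_sum_row. Qed.

Lemma submod_lc (M : lmodType R) b (g : 'I_b -> M) (U : set M) c :
  submod U -> (forall i, U (g i)) -> U (lc g c).
Proof. by move=> sU Ug; apply: submod_sum => // i _; case: sU => _ _; apply. Qed.

(** Induction on [p]: the first coordinates of [U] form an ideal, whose generators lift to the rows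
    of [E]; the remainder has first coordinate 0 and falls under the induction hypothesis. *)
Lemma noetherian_rV p (U : set 'rV[R]_p) : submod U ->
  exists b (D : 'M[R]_(b, p)), forall u, U u <-> exists v, u = v *m D.
Proof.
elim: p U => [|p IHp].
  move=> U sU;exists 0%N, 0 => u; split=> [_|_]; first by exists 0; rewrite [u]thinmx0 mulmx0.
  by rewrite [u]thinmx0; case: sU.
rewrite -[p.+1]/(1 + p)%N => U sU.
pose emb := fun v : 'rV[R]_p => row_mx (0 : 'rV[R]_1) v : 'rV[R]_(1 + p).
pose U' := [set v : 'rV[R]_p | U (emb v)].
have [U0 UD UZ] := sU.
have sU' : submod U'.
  split=> [|x y Ux Uy|a x Ux]; rewrite /U' /emb /=.
  - by rewrite row_mx0.
  - by rewrite -[0 as X in row_mx X](addr0 (0 : 'rV_1)) -add_row_mx; apply: UD.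
  - by rewrite -(scaler0 _ a) -scale_row_mx; apply: UZ.
have [b [D DP]] := IHp _ sU'.
pose I := [set a : R | exists u : 'rV[R]_(1 + p), U u /\ u 0 0 = a].
have idI : ideal I.
  split=> [|_ _ [u [Uu <-]] [v [Uv <-]]|a _ [u [Uu <-]]].
  - by exists 0; rewrite mxE.
  - by exists (u + v); rewrite mxE; split=> //; apply: UD.
  - by exists (a *: u); rewrite mxE; split=> //; apply: UZ.
have [x Ix] := noethR idI.
have lift (i : 'I_(size x)) : exists u : 'rV[R]_(1 + p), U u /\ u 0 0 = x`_i.
  suff : I x`_i by [].
  by rewrite Ix; apply: seq_smul_nth.
have [g gP] := choice lift.
pose E : 'M[R]_(size x, 1 + p) := \matrix_i g i.
have UE c : U (c *m E).
  rewrite -lc_row; apply: submod_lc => // i; rewrite rowK; exact: (gP i).1.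
exists (size x + b)%N, (col_mx E (row_mx 0 D)) => u; split.
  move=> Uu; have : seq_smul R^o x (u 0 0) by rewrite -Ix; exists u.
  case=> v vP.
  pose c : 'rV[R]_(size x) := \row_i v i.
  have : U (u - c *m E) by apply: submodB.
  set w := u - _; have wE : w = emb (rsubmx w).
    suff w0 : lsubmx w = 0 by rewrite /emb -w0 hsubmxK.
    apply/rowP => j; rewrite ord1 !mxE (_ : lshift p 0 = 0); last exact: val_inj.
    rewrite vP; apply/eqP; rewrite subr_eq0; apply/eqP; apply: eq_bigr => i _.
    by rewrite !mxE (gP i).2 /GRing.scale /= mulrC.
  rewrite {1}wE => /DP[d dP]; exists (row_mx c d).
  rewrite mul_row_col mul_mx_row mulmx0 -dP -/(emb _) -wE.
  by rewrite addrC subrK.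
case=> v ->; rewrite -[v]hsubmxK mul_row_col.
apply: UD => //; rewrite mul_mx_row mulmx0.
suff : U' (rsubmx v *m D) by [].
by apply/DP; exists (rsubmx v).
Qed.

End Noetherian.

(** * Vectors with entries in an ideal, and images of matrices *)

Definition vec (R : comNzRingType) (I : set R) p : set 'rV[R]_p :=
  [set u | forall j, I (u 0 j)].
Arguments vec {R} I p.

Section VectorSubmodules.
Variable R : comNzRingType.
Implicit Types I J : set R.

Lemma vec_submod I p : ideal I -> submod (vec I p).
Proof.
move=> [I0 ID IZ]; split=> [j|x y Ix Iy j|a x Ix j]; rewrite mxE //.
- exact: ID.
- exact: IZ.
Qed.

Lemma vecS I J p : I `<=` J -> vec I p `<=` vec J p.
Proof. by move=> IJ u Iu j; apply: IJ. Qed.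

Lemma vec_mulmx I p q (u : 'rV[R]_p) (A : 'M_(p, q)) :
  ideal I -> vec I p u -> vec I q (u *m A).
Proof.
move=> idI Iu j; rewrite mxE; apply: (submod_sum (M := R^o)) => [|i _]; first exact: idI.
by rewrite mulrC; case: idI => _ _; apply.
Qed.

Lemma vec_mulmxr I p q (u : 'rV[R]_p) (A : 'M_(p, q)) :
  ideal I -> (forall i j, I (A i j)) -> vec I q (u *m A).
Proof.
move=> idI IA j; rewrite mxE; apply: (submod_sum (M := R^o)) => [|i _]; first exact: idI.
by case: idI => _ _; apply.
Qed.

Lemma vec0 p : vec [set 0] p = [set 0 : 'rV[R]_p].
Proof.
apply/seteqP; split=> u; first by move=> u0; apply/rowP => j; rewrite u0 mxE.
by move=> -> j; rewrite mxE.
Qed.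

(** Vectors are rows throughout: [D] stands for the map v |-> v D. *)
Definition mxim p q (D : 'M[R]_(p, q)) : set 'rV[R]_q := [set u | exists v, u = v *m D].

Lemma mxim_submod p q (D : 'M[R]_(p, q)) : submod (mxim D).
Proof.
split=> [|_ _ [x ->] [y ->]|a _ [x ->]]; first by exists 0; rewrite mul0mx.
  by exists (x + y); rewrite mulmxDl.
by exists (a *: x); rewrite scalemxAl.
Qed.

Lemma mxim_row p q (D : 'M[R]_(p, q)) i : mxim D (row i D).
Proof. by exists (delta_mx 0 i); rewrite -rowE. Qed.

End VectorSubmodules.

(** Together with [cons_mx] this adds one matrix at the low end of a complex; the match on the
    degree makes the sizes agree by computation. *)
Definition cons_dim (p0 : nat) (q : nat -> nat) (i : nat) : nat :=
  if i is j.+1 then q j else p0.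

Definition cons_mx (R : comNzRingType) p0 q (A0 : 'M[R]_(q 0%N, p0))
    (A : forall i, 'M[R]_(q i.+1, q i)) i :
    'M[R]_(cons_dim p0 q i.+1, cons_dim p0 q i) :=
  match i with 0 => A0 | j.+1 => A j end.

(** * Minimal generators, minimal resolutions and Nakayama over a local ring *)

Section Local.
Variables (R : comNzRingType) (m : set R) (hR : noetherian_local m).

Lemma local_ideal : ideal m.
Proof. by case: hR => _ []. Qed.

Lemma local_not1 : ~ m 1.
Proof. by case: hR => _ []. Qed.

Lemma local_noetherian : noetherian R.
Proof. by case: hR. Qed.

Lemma minimal_generators (M : lmodType R) (U V : set M) b (g : 'I_b -> M) :
  submod U -> (forall i, V (g i)) ->
  (forall v, V v -> exists c, U (v - lc g c)) ->
  exists b' (g' : 'I_b' -> M),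
    [/\ forall i, V (g' i), forall v, V v -> exists c, U (v - lc g' c)
      & forall c, U (lc g' c) -> vec m b' c].
Proof.
move=> sU; elim: b g => [|b IHb] g Vg genV.
  by exists 0%N, g; split=> // c _ [].
have [minU|] := pselect (forall c, U (lc g c) -> vec m b.+1 c).
  by exists b.+1, g.
move=> /existsNP[c /not_implyP[Uc /existsNP[i nmc]]].
have [r rc] := local_unit local_noetherian hR nmc.
apply: (IHb (fun j => g (lift i j))) => [j|v Vv]; first exact: Vg.
have [d Ud] := genV v Vv.
(* Subtracting this multiple of the relation [c] makes the [i]-th coordinate vanish. *)
pose d' := d - (d 0 i * r) *: c; exists (\row_j d' 0 (lift i j)).
have -> : lc (fun j => g (lift i j)) (\row_j d' 0 (lift i j)) = lc g d'.
  rewrite [RHS]/lc (bigD1_ord i) //= [X in _ = X + _](_ : _ = 0) ?add0r.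
    by apply: eq_bigr => j _; rewrite mxE.
  by rewrite !mxE -mulrA rc mulr1 subrr scale0r.
rewrite linearB linearZ opprB addrA addrAC.
have [_ UD UZ] := sU; apply: UD => //; last exact: UZ.
Qed.

Lemma minimal_matrix p (K : set 'rV[R]_p) : submod K ->
  exists b (D : 'M[R]_(b, p)),
    (forall u, K u <-> mxim D u) /\ (forall v, v *m D = 0 -> vec m b v).
Proof.
move=> sK; have [b [D DP]] := noetherian_rV local_noetherian sK.
have [|i|v|b' [g [Kg genK ming]]] :=
    @minimal_generators _ [set 0] K b (fun i => row i D).
- exact: submod0.
- by apply/DP; apply: mxim_row.
- by move=> /DP[c ->]; exists c; rewrite lc_row subrr.
exists b', (\matrix_i g i).
have gE c : c *m (\matrix_i g i) = lc g c.
  by rewrite -lc_row; apply: eq_bigr => i _; rewrite rowK.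
split=> [u|v]; last by rewrite gE; apply: ming.
split; first by move=> /genK[c /eqP]; rewrite subr_eq0 => /eqP ->; exists c; rewrite gE.
by case=> v ->; rewrite gE; apply: submod_lc.
Qed.

(** Each matrix presents the kernel of the preceding one minimally; a row of [A i] is a relation
    among minimal generators, so its entries lie in [m]. *)
Lemma minimal_resolution p0 (K : set 'rV[R]_p0) : submod K ->
  exists (q : nat -> nat) (A0 : 'M[R]_(q 0%N, p0)) (A : forall i, 'M[R]_(q i.+1, q i)),
    [/\ forall u, K u <-> mxim A0 u,
        forall u, u *m A0 = 0 <-> mxim (A 0%N) u,
        forall i u, u *m A i = 0 <-> mxim (A i.+1) u
      & forall i a b, m (A i a b)].
Proof.
move=> sK; have [b0 [D0 [D0P minD0]]] := minimal_matrix sK.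
(* Matrices are packed with their sizes so that the construction can be iterated. *)
pose T := {bp : nat * nat & 'M[R]_(bp.1, bp.2)}.
have ex (s : T) : exists bD : {b & 'M[R]_(b, (tag s).1)},
    (forall u, u *m tagged s = 0 <-> mxim (tagged bD) u) /\
    (forall v, v *m tagged bD = 0 -> vec m (tag bD) v).
  have [|b [D HD]] := @minimal_matrix _ [set u | u *m tagged s = 0]; last first.
    by exists (Tagged (fun b => 'M[R]_(b, (tag s).1)) D).
  split=> [|x y /= x0 y0|a x /= x0] /=; first by rewrite mul0mx.
    by rewrite mulmxDl x0 y0 addr0.
  by rewrite -scalemxAl x0 scaler0.
have [nxt nxtP] : {nxt : forall s : T, {b & 'M[R]_(b, (tag s).1)} | forall s,
    (forall u, u *m tagged s = 0 <-> mxim (tagged (nxt s)) u) /\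
    (forall v, v *m tagged (nxt s) = 0 -> vec m (tag (nxt s)) v)}.
  by exists (fun s => projT1 (cid (ex s))) => s; apply: (projT2 (cid (ex s))).
pose step (s : T) : T := Tagged (fun bp : nat * nat => 'M[R]_(bp.1, bp.2))
  (tagged (nxt s) : 'M[R]_((tag (nxt s), (tag s).1).1, (tag (nxt s), (tag s).1).2)).
pose s0 : T := Tagged (fun bp : nat * nat => 'M[R]_(bp.1, bp.2))
  (D0 : 'M[R]_((b0, p0).1, (b0, p0).2)).
pose st i := iter i step s0.
pose q i := (tag (st i)).1.
exists q, D0, (fun i => tagged (nxt (st i)) : 'M[R]_(q i.+1, q i)).
have minst i v : v *m tagged (st i) = 0 -> vec m (q i) v.
  by case: i v => [|i] v; [apply: minD0|apply: (nxtP _).2].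
split=> //.
- exact: (nxtP s0).1.
- by move=> i; apply: (nxtP (st i.+1)).1.
- move=> i a b; have /(minst i) : row a (tagged (nxt (st i))) *m tagged (st i) = 0.
    by apply/(nxtP (st i)).1; apply: mxim_row.
  by move=> /(_ b); rewrite mxE.
Qed.

(** If a minimal generating family is nonempty, its first member is a combination of the family with
    coefficients in [m]. This is a relation with first coefficient 1 minus an element of [m]; by
    minimality that lies in [m], hence so does 1. *)
Lemma nakayama (M : lmodType R) (L : set M) b (g : 'I_b -> M) :
  submod L -> (forall i, L (g i)) -> (forall v, L v -> exists c, v = lc g c) ->
  (forall u, L u -> exists k (h : 'I_k -> M) c,
     [/\ forall i, L (h i), vec m k c & u = lc h c]) ->
  forall u, L u -> u = 0.
Proof.
move=> sL Lg genL mL.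
have [||v|b' [g' [Lg' genL' ming]]] := @minimal_generators _ [set 0] L b g => //.
- exact: submod0.
- by move=> /genL[c ->]; exists c; rewrite subrr.
have {}genL' v : L v -> exists c, v = lc g' c.
  by move=> /genL'[c /eqP]; rewrite subr_eq0 => /eqP ->; exists c.
case: b' g' Lg' genL' ming => [|b'] g' Lg' genL' ming.
  by move=> u /genL'[c ->]; rewrite /lc big_ord0.
have [k [h [c [Lh mc gE]]]] := mL _ (Lg' ord0).
have [d dP] := choice (fun i => genL' _ (Lh i)).
pose e := \sum_i c 0 i *: d i.
have : lc g' (delta_mx 0 0 - e) = 0.
  rewrite linearB /= lc_delta gE; apply/eqP; rewrite subr_eq0; apply/eqP.
  rewrite [RHS](linear_sum (lc g')); apply: eq_bigr => i _.
  by rewrite dP -linearZ.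
move=> /ming/(_ 0); rewrite !mxE !eqxx /= => m1e.
case: local_not1; apply: (submod_subr (M := R^o) local_ideal) m1e.
rewrite summxE; apply: (submod_sum (M := R^o)) => [|i _]; first exact: local_ideal.
by rewrite mxE mulrC; case: local_ideal => _ _; apply.
Qed.

End Local.

(** * Complexes of matrices tensored with a subquotient V / U *)

Section Action.
Variable R : comNzRingType.
Implicit Types M : lmodType R.

(** The map M^p -> M^q obtained by tensoring [A] : R^p -> R^q with M. *)
Definition act M p q (A : 'M[R]_(p, q)) (z : 'I_p -> M) : 'I_q -> M :=
  fun b => \sum_a A a b *: z a.

Lemma act_comp M p q r (A : 'M[R]_(p, q)) (B : 'M[R]_(q, r)) (z : 'I_p -> M) c :
  act B (act A z) c = act (A *m B) z c.
Proof.
rewrite /act; under eq_bigr do rewrite scaler_sumr.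
rewrite exchange_big; apply: eq_bigr => a _; rewrite mxE scaler_suml.
by apply: eq_bigr => b _; rewrite scalerA mulrC.
Qed.

Lemma act0 M p q (z : 'I_p -> M) (c : 'I_q) : act 0 z c = 0.
Proof. by rewrite /act big1 // => a _; rewrite mxE scale0r. Qed.

Lemma actD M p q (A : 'M[R]_(p, q)) (z w : 'I_p -> M) b :
  act A (fun a => z a + w a) b = act A z b + act A w b.
Proof. by rewrite /act -big_split; apply: eq_bigr => a _; rewrite scalerDr. Qed.

Lemma actB M p q (A : 'M[R]_(p, q)) (z w : 'I_p -> M) b :
  act A (fun a => z a - w a) b = act A z b - act A w b.
Proof. by rewrite /act -sumrB; apply: eq_bigr => a _; rewrite scalerBr. Qed.

Lemma act_submod M p q (A : 'M[R]_(p, q)) (z : 'I_p -> M) (U : set M) b :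
  submod U -> (forall a, U (z a)) -> U (act A z b).
Proof. by move=> sU Uz; apply: submod_sum => // a _; case: sU => _ _; apply. Qed.

Lemma linear_act M M' (f : {linear M -> M'}) p q (A : 'M[R]_(p, q)) (z : 'I_p -> M) b :
  f (act A z b) = act A (f \o z) b.
Proof. by rewrite /act linear_sum; apply: eq_bigr => a _; rewrite linearZ. Qed.

Lemma eq_act M p q (A : 'M[R]_(p, q)) (z w : 'I_p -> M) b :
  z =1 w -> act A z b = act A w b.
Proof. by move=> zw; apply: eq_bigr => a _; rewrite zw. Qed.

End Action.

(* When (p, A) is a free resolution of N, [exact_at i U V] says
   Tor_(i+1)(N, V / U) = 0; the quotient V / U is not formed. *)
Definition exact_at (R : comNzRingType) (p : nat -> nat)
    (A : forall i, 'M[R]_(p i.+1, p i)) (M : lmodType R) i (U V : set M) : Prop :=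
  forall z : 'I_(p i.+1) -> M, (forall a, V (z a)) -> (forall b, U (act (A i) z b)) ->
  exists w : 'I_(p i.+2) -> M,
    (forall a, V (w a)) /\ forall a, U (z a - act (A i.+1) w a).

Section Complex.
Variables (R : comNzRingType) (p : nat -> nat) (A : forall i, 'M[R]_(p i.+1, p i)).
Hypothesis AA : forall i, A i.+1 *m A i = 0.
Implicit Types M : lmodType R.
Local Notation exact_at := (exact_at A).

Lemma act_act M i (z : 'I_(p i.+2) -> M) b : act (A i) (act (A i.+1) z) b = 0.
Proof. by rewrite act_comp AA act0. Qed.

(** This and the next two lemmas are the stretches of the long exact Tor sequence of 0 -> V/U -> W/U
    -> W/V -> 0 around its middle, last and first term, chased on representatives. *)
Lemma exact_at_ext M i (U V W : set M) :
  submod U -> submod V -> submod W -> U `<=` V -> V `<=` W ->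
  exact_at i U V -> exact_at i V W -> exact_at i U W.
Proof.
move=> sU sV sW UV VW exV exW z Wz Uz.
have [w [Ww Vw]] := exW z Wz (fun b => UV _ (Uz b)).
have [b|w' [Vw' Uw']] := exV _ Vw.
  by rewrite actB act_act subr0; apply: Uz.
have [_ WD _] := sW; exists (fun a => w a + w' a); split=> a.
  by apply: WD => //; apply: VW.
by rewrite actD opprD addrA.
Qed.

Lemma exact_at_quot M i (U V W : set M) :
  submod U -> submod V -> submod W -> U `<=` V -> V `<=` W ->
  exact_at i U V -> exact_at i.+1 U W -> exact_at i.+1 V W.
Proof.
move=> sU sV sW UV VW exV exW z Wz Vz.
have [b|w [Vw Uw]] := exV _ Vz; first by rewrite act_act; case: sU.
have [a|b|v [Wv Uv]] := exW (fun a => z a - w a).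
- by apply: submodB => //; apply: VW.
- by rewrite actB.
- exists v; split=> // a; apply: (submod_subr sV (Vw a)).
  by rewrite addrAC; apply: UV.
Qed.

Lemma exact_at_sub M i (U V W : set M) :
  submod U -> submod V -> submod W -> U `<=` V -> V `<=` W ->
  exact_at i U W -> exact_at i.+1 V W -> exact_at i U V.
Proof.
move=> sU sV sW UV VW exU exV z Vz Uz.
have [w [Ww Uw]] := exU z (fun a => VW _ (Vz a)) Uz.
have [b|v [Wv Vv]] := exV w Ww.
  by apply: (submod_subr sV (Vz b)); apply: submodBC => //; apply: UV.
exists (fun a => w a - act (A i.+2) v a); split=> // a.
by rewrite actB act_act subr0.
Qed.

(** Split a preimage [w] in [W] into parts in [V] and [V']. The image of the second part lies in
    [V'] and also in [V], hence in [U]; so the first part is a preimage modulo [U]. *)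
Lemma exact_at_summand M i (U V V' W : set M) :
  submod U -> submod V -> submod V' ->
  U `<=` V -> U `<=` V' -> V `<=` W -> W `<=` submod_sumset V V' -> V `&` V' `<=` U ->
  exact_at i U W -> exact_at i U V.
Proof.
move=> sU sV sV' UV UV' VW WVV' VV'U exU z Vz Uz.
have [w [Ww Uw]] := exU z (fun a => VW _ (Vz a)) Uz.
have split_w a : exists vv : M * M, [/\ V vv.1, V' vv.2 & w a = vv.1 + vv.2].
  by have [v [v' [Vv Vv' E]]] := WVV' _ (Ww a); exists (v, v').
have [vv vvP] := choice split_w.
have Vv a : V (vv a).1 by case: (vvP a).
have Vv' a : V' (vv a).2 by case: (vvP a).
exists (fun a => (vv a).1); split=> // a.
have wE : act (A i.+1) w a =
    act (A i.+1) (fun a => (vv a).1) a + act (A i.+1) (fun a => (vv a).2) a.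
  by rewrite -actD; apply: eq_act => b; case: (vvP b).
have Uz' := Uw a; move: (Uz'); rewrite wE opprD addrA.
set y := z a - _ => Uy; apply: (submod_subr sU _ Uy); apply: VV'U; split.
  have Vy : V y by apply: submodB => //; apply: act_submod.
  by apply: (submod_subr sV Vy); apply: submodBC => //; apply: UV.
exact: act_submod.
Qed.

(** The conditions say that [f] induces an isomorphism from V / U to V' / U'. *)
Lemma exact_at_iso M M' (f : {linear M -> M'}) i (U V : set M) (U' V' : set M') :
  submod V -> submod U' -> submod V' ->
  (forall x, V x -> V' (f x)) -> (forall y, V' y -> exists x, V x /\ U' (y - f x)) ->
  (forall x, V x -> (U x <-> U' (f x))) ->
  exact_at i U V <-> exact_at i U' V'.
Proof.
move=> sV sU' sV' Vf fV Uf; have [_ UD' _] := sU'; split=> exU z Vz Uz.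
  have [x xP] := choice (fun a => fV _ (Vz a)).
  have Vx a : V (x a) := (xP a).1.
  have Ux a : U' (z a - f (x a)) := (xP a).2.
  have [|b|w [Vw Uw]] := exU x => //.
    apply/Uf; first exact: act_submod.
    rewrite linear_act; apply: (submod_subr sU' (Uz b)); apply: submodBC => //.
    by rewrite -actB; apply: act_submod.
  exists (f \o w); split=> [a|a] /=; first exact: Vf.
  rewrite -linear_act -(subrKA (f (x a))) -linearB; apply: UD' => //.
  by apply/Uf => //; apply: submodB => //; apply: act_submod.
have [a|b|w [Vw Uw]] := exU (f \o z); first exact: Vf.
  by rewrite -linear_act; apply/Uf => //; apply: act_submod.
have [x xP] := choice (fun a => fV _ (Vw a)).
have Vx a : V (x a) := (xP a).1.
exists x; split=> // a; apply/Uf; first by apply: submodB => //; apply: act_submod.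
rewrite linearB linear_act -(subrKA (act (A i.+1) w a)); apply: UD'; first exact: Uw.
rewrite -actB; apply: act_submod => // b; exact: (xP b).2.
Qed.

Lemma exact_at_vec i (U V : set R^o) q :
  exact_at i U V -> exact_at i (vec U q) (vec V q).
Proof.
move=> exU z Vz Uz.
have actE k l (B : 'M_(k, l)) (y : 'I_k -> 'rV[R]_q) b j :
    act B y b 0 j = act B (fun a => y a 0 j : R^o) b.
  by rewrite /act summxE; apply: eq_bigr => a _; rewrite mxE.
have [j|w wP] := choice (fun j => exU (fun a => z a 0 j) (fun a => Vz a j) _).
  by move=> b; rewrite -actE; apply: Uz.
exists (fun a => \row_j w j a); split=> a j; first by rewrite mxE; apply: (wP j).1.
rewrite !mxE actE (_ : act _ _ _ = act (A i.+1) (w j) a); first exact: (wP j).2.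
by apply: eq_act => b; rewrite mxE.
Qed.

Definition tor_small M (U V : set M) : Prop :=
  exists i0, forall i, (i0 <= i)%N -> exact_at i U V.

Lemma tor_small_ext M (U V W : set M) :
  submod U -> submod V -> submod W -> U `<=` V -> V `<=` W ->
  tor_small U V -> tor_small V W -> tor_small U W.
Proof.
move=> sU sV sW UV VW [i iP] [j jP]; exists (maxn i j) => k; rewrite geq_max.
by case/andP=> ik jk; apply: (exact_at_ext sU sV sW) => //; [apply: iP|apply: jP].
Qed.

Lemma tor_small_quot M (U V W : set M) :
  submod U -> submod V -> submod W -> U `<=` V -> V `<=` W ->
  tor_small U V -> tor_small U W -> tor_small V W.
Proof.
move=> sU sV sW UV VW [i iP] [j jP]; exists (maxn i j).+1 => -[//|k].
rewrite ltnS geq_max => /andP[ik jk].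
by apply: (exact_at_quot sU sV sW) => //; [apply: iP|apply/jP/leqW].
Qed.

Lemma tor_small_sub M (U V W : set M) :
  submod U -> submod V -> submod W -> U `<=` V -> V `<=` W ->
  tor_small U W -> tor_small V W -> tor_small U V.
Proof.
move=> sU sV sW UV VW [i iP] [j jP]; exists (maxn i j) => k; rewrite geq_max.
case/andP=> ik jk.
by apply: (exact_at_sub sU sV sW) => //; [apply: iP|apply/jP/leqW].
Qed.

Lemma tor_small_summand M (U V V' W : set M) :
  submod U -> submod V -> submod V' ->
  U `<=` V -> U `<=` V' -> V `<=` W -> W `<=` submod_sumset V V' -> V `&` V' `<=` U ->
  tor_small U W -> tor_small U V.
Proof.
move=> sU sV sV' UV UV' VW WVV' VV'U [i iP]; exists i => k ik.
exact: (exact_at_summand sU sV sV' UV UV' VW WVV' VV'U (iP _ ik)).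
Qed.

Lemma tor_small_iso M M' (f : {linear M -> M'}) (U V : set M) (U' V' : set M') :
  submod V -> submod U' -> submod V' ->
  (forall x, V x -> V' (f x)) -> (forall y, V' y -> exists x, V x /\ U' (y - f x)) ->
  (forall x, V x -> (U x <-> U' (f x))) ->
  tor_small U V <-> tor_small U' V'.
Proof.
move=> sV sU' sV' Vf fV Uf; split=> -[i iP]; exists i => k ik.
  exact: ((exact_at_iso _ sV sU' sV' Vf fV Uf).1 (iP _ ik)).
exact: ((exact_at_iso _ sV sU' sV' Vf fV Uf).2 (iP _ ik)).
Qed.

Lemma tor_small_vec (U V : set R^o) q :
  tor_small U V -> tor_small (vec U q) (vec V q).
Proof. by move=> [i iP]; exists i => k ik; apply/exact_at_vec/iP. Qed.

(** V / U embeds as the [j]-th summand of V^q / U^q, with the coordinate map as retraction. *)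
Lemma exact_at_component (U V : set R) q (j : 'I_q) i :
  ideal U -> ideal V -> exact_at i (vec U q) (vec V q) -> exact_at i (U : set R^o) V.
Proof.
move=> idU idV exUV z Vz Uz.
have cL : linear (fun u : 'rV[R]_q => u 0 j : R^o) by move=> a x y; rewrite !mxE.
have [c cE] := linear_of_fun cL.
have dL : linear (fun x : R^o => (x : R) *: delta_mx 0 j : 'rV[R]_q).
  by move=> a x y; rewrite scalerDl scalerA.
have [d dE] := linear_of_fun dL.
have cd x : c (d x) = x by rewrite cE dE !mxE !eqxx mulr1.
have dvec (I : set R) x : ideal I -> I x -> vec I q (d x).
  move=> [I0 _ IZ] Ix k; rewrite dE !mxE eqxx /=; case: (k == j); rewrite ?mulr1 //.
  by rewrite mulr0.
have [a|b|w [Vw Uw]] := exUV (d \o z); first by apply: dvec.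
  by rewrite -linear_act; apply: dvec.
exists (c \o w); split=> a /=; first by rewrite cE; apply: Vw.
by rewrite -linear_act -{1}(cd (z a)) -linearB cE; apply: Uw.
Qed.

Lemma tor_small_component (U V : set R) q (j : 'I_q) :
  ideal U -> ideal V -> tor_small (vec U q) (vec V q) -> tor_small (U : set R^o) V.
Proof.
move=> idU idV [i0 exUV]; exists i0 => i i0i.
exact: (exact_at_component j idU idV (exUV i i0i)).
Qed.

Lemma exact_at_free i : (forall u, u *m A i = 0 -> mxim (A i.+1) u) ->
  exact_at i ([set 0] : set R^o) setT.
Proof.
move=> exA z _ z0; have [|w wE] := exA (\row_a z a).
  apply/rowP => b; rewrite !mxE -[RHS](z0 b).
  by apply: eq_bigr => a _; rewrite mxE mulrC.
exists (fun a => w 0 a); split=> // a; apply/eqP; rewrite subr_eq0; apply/eqP.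
have /rowP/(_ a) := wE; rewrite !mxE => ->.
by apply: eq_bigr => c _; rewrite mulrC.
Qed.

End Complex.

(** * Regular sequences and small Tor *)

Section RegularSequence.
Variables (R : comNzRingType) (x : nat -> R).
Implicit Types M : lmodType R.

(* (x_0, ..., x_(i-1)) Z *)
Fixpoint reg_smul M (Z : set M) i : set M :=
  if i is k.+1 then [set u | exists w v, [/\ reg_smul Z k w, Z v & u = w + x k *: v]]
  else [set 0].

Lemma reg_smul_submod M (Z : set M) i : submod Z -> submod (reg_smul Z i).
Proof.
move=> sZ; elim: i => [|i IHi] /=; first exact: submod0.
have [Z0 ZD ZZ] := sZ; have [I0 ID IZ] := IHi; split.
- by exists 0, 0; rewrite scaler0 addr0.
- move=> _ _ [w [v [Iw Zv ->]]] [w' [v' [Iw' Zv' ->]]].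
  exists (w + w'), (v + v'); rewrite scalerDr addrACA; split=> //; first exact: ID.
  exact: ZD.
- move=> a _ [w [v [Iw Zv ->]]]; exists (a *: w), (a *: v).
  by rewrite scalerDr !scalerA mulrC; split=> //; [apply: IZ|apply: ZZ].
Qed.

Lemma reg_smul_sub M (Z : set M) i : submod Z -> reg_smul Z i `<=` Z.
Proof.
move=> [Z0 ZD ZZ]; elim: i => [|i IHi] /= u; first by move=> ->.
by move=> [w [v [/IHi Zw Zv ->]]]; apply: ZD => //; apply: ZZ.
Qed.

Lemma reg_smulS M (Z : set M) i : Z 0 -> reg_smul Z i `<=` reg_smul Z i.+1.
Proof. by move=> Z0 u Iu; exists u, 0; rewrite scaler0 addr0. Qed.

Lemma reg_smul_mono M (Z Z' : set M) i : Z `<=` Z' -> reg_smul Z i `<=` reg_smul Z' i.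
Proof.
move=> ZZ'; elim: i => [|i IHi] //= u [w [v [Zw Zv ->]]].
by exists w, v; split; [apply: IHi|apply: ZZ'|].
Qed.

Lemma reg_smul_sum M (Z : set M) i u : Z 0 ->
  reg_smul Z i u <->
  exists v : nat -> M, (forall j, Z (v j)) /\ u = \sum_(j < i) x j *: v j.
Proof.
move=> Z0; elim: i u => [|i IHi] u /=.
  split=> [->|[v [_ ->]]]; last by rewrite big_ord0.
  by exists (fun=> 0); rewrite big_ord0.
split=> [[w [v [/IHi[v' [Zv' ->]] Zv ->]]]|[v [Zv ->]]].
  exists (fun j => if j == i then v else v' j); split=> [j|]; first by case: ifP.
  rewrite big_ord_recr /= eqxx; congr (_ + _); apply: eq_bigr => j _.
  by rewrite ltn_eqF.
exists (\sum_(j < i) x j *: v j), (v i); rewrite big_ord_recr; split=> //.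
by apply/IHi; exists v.
Qed.

Lemma reg_smul_linear M M' (f : {linear M -> M'}) (Z : set M) (Z' : set M') i u :
  (forall z, Z z -> Z' (f z)) -> reg_smul Z i u -> reg_smul Z' i (f u).
Proof.
move=> ZZ'; elim: i u => [|i IHi] u /=; first by move=> ->; rewrite linear0.
move=> [w [v [Zw Zv ->]]]; exists (f w), (f v).
by rewrite linearD linearZ; split; [apply: IHi|apply: ZZ'|].
Qed.

Lemma reg_smul_lift M M' (f : {linear M -> M'}) (Z : set M) (Z' : set M') i u' :
  (forall z', Z' z' -> exists z, Z z /\ f z = z') ->
  reg_smul Z' i u' -> exists u, reg_smul Z i u /\ f u = u'.
Proof.
move=> ZZ'; elim: i u' => [|i IHi] u' /=; first by move=> ->; exists 0; rewrite linear0.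
move=> [_ [_ [/IHi[w [Zw <-]] /ZZ'[v [Zv <-]] ->]]]; exists (w + x i *: v).
by rewrite linearD linearZ; split=> //; exists w, v.
Qed.

Lemma reg_smul_vec p i (u : 'rV[R]_p) :
  reg_smul setT i u <-> vec (reg_smul (setT : set R^o) i) p u.
Proof.
split=> [Iu j|].
  have cL : linear (fun u : 'rV[R]_p => u 0 j : R^o) by move=> a y z; rewrite !mxE.
  by have [c cE] := linear_of_fun cL; rewrite -cE; apply: reg_smul_linear Iu.
move=> Iu; have [v vP] := choice (fun j => (@reg_smul_sum R^o setT i (u 0 j) I).1 (Iu j)).
apply/reg_smul_sum => //; exists (fun k => \row_j v j k); split=> //.
apply/rowP => j; rewrite summxE (vP j).2; apply: eq_bigr => k _.
by rewrite !mxE.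
Qed.

Lemma reg_smul_ideal i : ideal (reg_smul (setT : set R^o) i).
Proof. exact: (reg_smul_submod i (submodT R^o)). Qed.

(** Weak regularity: Z = (x) Z is allowed. *)
Definition regular_upto M (Z : set M) n : Prop :=
  forall k, (k < n)%N -> forall u, Z u -> reg_smul Z k (x k *: u) -> reg_smul Z k u.

Lemma regular_upto_rV n p : regular_upto (setT : set R^o) n ->
  regular_upto (setT : set 'rV[R]_p) n.
Proof.
move=> regR k kn u _ /reg_smul_vec Iu; apply/reg_smul_vec => j; apply: (regR k) => //.
by have := Iu j; rewrite mxE.
Qed.

Variables (p : nat -> nat) (A : forall i, 'M[R]_(p i.+1, p i)).
Hypothesis AA : forall i, A i.+1 *m A i = 0.
Local Notation tor_small := (tor_small A).

(** Multiplication by x_k maps Z / Z_k isomorphically onto Z_(k+1) / Z_k, where Z_k is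
    [reg_smul Z k]. *)
Lemma scale_iso M (Z : set M) k : submod Z ->
  (forall u, Z u -> reg_smul Z k (x k *: u) -> reg_smul Z k u) ->
  forall i, exact_at A i (reg_smul Z k) Z <-> exact_at A i (reg_smul Z k) (reg_smul Z k.+1).
Proof.
move=> sZ regk i; have fL : linear (fun v : M => x k *: v).
  by move=> a u v; rewrite scalerDr !scalerA mulrC.
have [f fE] := linear_of_fun fL; have sI := reg_smul_submod k sZ.
apply: (exact_at_iso A (f := f)) => //; first exact: reg_smul_submod.
- by move=> v Zv; exists 0, v; rewrite add0r fE; split=> //; case: sI.
- by move=> _ [w [v [Zw Zv ->]]]; exists v; rewrite fE addrK.
- by move=> v Zv; rewrite fE; split; [case: sI => _ _; apply|apply: regk].
Qed.

(** Induction along 0 -> Z / Z_i -> Z / Z_i -> Z / Z_(i+1) -> 0 with Z_i = [reg_smul Z i], the first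
    map being multiplication by x_i. *)
Lemma tor_small_reg_smul M (Z : set M) n : submod Z -> regular_upto Z n ->
  tor_small [set 0] Z -> forall i, (i <= n)%N -> tor_small (reg_smul Z i) Z.
Proof.
move=> sZ regZ ZT; elim=> [//|i IHi] lt_in.
have Z0 : Z 0 by case: sZ.
have {}IHi := IHi (ltnW lt_in).
apply: (tor_small_quot AA (reg_smul_submod i sZ) (reg_smul_submod i.+1 sZ) sZ) => //.
- exact: reg_smulS.
- exact: reg_smul_sub.
case: IHi => i0 i0P; exists i0 => k /i0P/scale_iso; apply=> //.
exact: regZ.
Qed.

Lemma exact_at_rV i q : exact_at A i ([set 0] : set R^o) setT ->
  exact_at A i ([set 0] : set 'rV[R]_q) setT.
Proof.
move=> /(@exact_at_vec _ _ _ _ _ _ q).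
rewrite (_ : vec [set 0] q = [set 0]); last exact: vec0.
by rewrite (_ : vec setT q = setT) // -subTset.
Qed.

(** [D] induces an isomorphism from R^q / im D' to im D. *)
Lemma exact_at_mxim i r q s (D : 'M[R]_(q, s)) (D' : 'M[R]_(r, q)) :
  (forall u, u *m D = 0 <-> mxim D' u) ->
  exact_at A i (mxim D') setT <-> exact_at A i [set 0] (mxim D).
Proof.
move=> kerD; apply: (exact_at_iso A (f := mulmxr D)) => //.
- exact: submod0.
- exact: mxim_submod.
- by move=> u _; exists u.
- by move=> _ [v ->]; exists v; rewrite /= subrr.
- by move=> u _; split=> /kerD.
Qed.

Variable n : nat.
Hypothesis regR : regular_upto (setT : set R^o) n.
Hypothesis torR : tor_small ([set 0] : set R^o) setT.

Lemma tor_small_rV q : tor_small ([set 0] : set 'rV[R]_q) setT.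
Proof. by case: torR => i0 i0P; exists i0 => i /i0P; apply: exact_at_rV. Qed.

(* [im D] behaves like a (k+1)-st syzygy: it has small Tor, and no new relation
   appears modulo the first [k] elements of the regular sequence. *)
Definition syzygy_like k q s (D : 'M[R]_(q, s)) : Prop :=
  tor_small [set 0] (mxim D) /\
  forall i, (i <= k)%N -> (i <= n)%N -> forall u,
    reg_smul setT i u -> mxim D u -> reg_smul (mxim D) i u.

Lemma syzygy_like_regular k q s (D : 'M[R]_(q, s)) l :
  syzygy_like k D -> (l <= k.+1)%N -> (l <= n)%N -> regular_upto (mxim D) l.
Proof.
move=> [_ ED] lk ln i il u Du Iu.
apply: ED => //; first by rewrite -ltnS (leq_trans il).
- by rewrite ltnW // (leq_trans il).
- apply: (regular_upto_rV regR) => //; first exact: leq_trans il ln.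
  by apply: reg_smul_mono Iu.
Qed.

(** Tor is handled by dimension shifting. If w + x_i v is in ker D with w in (x_0, ..., x_(i-1)),
    then x_i (v D) is in (x_0, ..., x_(i-1)) im D. By regularity of im D so is v D, and v can be
    corrected by some w' in (x_0, ..., x_(i-1)) R^q to an element of ker D = im D'. *)
Lemma syzygy_like_step k r q s (D : 'M[R]_(q, s)) (D' : 'M[R]_(r, q)) :
  (forall u, u *m D = 0 <-> mxim D' u) -> syzygy_like k D -> syzygy_like k.+1 D'.
Proof.
move=> kerD synD; have [TD _] := synD; split.
  apply: (@tor_small_sub _ _ _ AA _ _ _ setT (submod0 _) (mxim_submod D')) => //.
  - by move=> _ ->; case: (mxim_submod D').
  - exact: tor_small_rV.
  - by case: TD => i0 i0P; exists i0 => i /i0P/(exact_at_mxim _ kerD).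
elim=> [|i IHi] ik lt_in u; first by move=> ->.
move=> /= [w [v [Iw _ ->]]] /kerD D0.
have /(reg_smul_lift (f := mulmxr D) (Z := setT))[|w' [Iw' w'E]] :
    reg_smul (mxim D) i (v *m D).
- apply: (syzygy_like_regular synD ik lt_in) => //; first by exists v.
  have -> : x i *: (v *m D) = mulmxr D (- w).
    by apply/eqP; rewrite /= mulNmx -addr_eq0 addrC scalemxAl -mulmxDl D0.
  apply: (reg_smul_linear (Z := setT)) => [z _|]; first by exists z.
  by apply: submodN => //; apply: reg_smul_submod.
- by move=> _ [z ->]; exists z.
have D'v : mxim D' (v - w') by apply/kerD; rewrite mulmxBl -w'E subrr.
exists (w + x i *: w'), (v - w'); split=> //; last by rewrite scalerBr addrACA subrr addr0.
apply: IHi; [exact: ltnW|exact: ltnW| |].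
  have [_ ID IZ] := reg_smul_submod i (submodT 'rV[R]_q).
  by apply: ID => //; apply: IZ.
apply/kerD; rewrite mulmxDl -scalemxAl (_ : w' *m D = v *m D) //.
by rewrite scalemxAl -mulmxDl.
Qed.

End RegularSequence.

(* The maximal ideal of R / a is the direct sum of the nonzero ideals I / a and J / a. *)
Record quasi_split (R : comNzRingType) (m a I J : set R) : Prop := QuasiSplit {
  split_ideal : ideal a;
  split_ideall : ideal I;
  split_idealr : ideal J;
  split_subl : a `<=` I;
  split_subr : a `<=` J;
  split_cap : I `&` J `<=` a;
  split_maxl : I `<=` m;
  split_maxr : J `<=` m;
  split_max : m `<=` submod_sumset (I : set R^o) J;
  split_neql : ~ (I `<=` a);
  split_neqr : ~ (J `<=` a) }.

Lemma quasi_splitC (R : comNzRingType) (m a I J : set R) :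
  quasi_split m a I J -> quasi_split m a J I.
Proof.
case=> ida idI idJ aI aJ IJ Im Jm mIJ nI nJ; split=> //; first by rewrite setIC.
by move=> r /mIJ[i [j [Ii Jj ->]]]; exists j, i; rewrite addrC.
Qed.

(** * Small modules over the fiber product R / a *)

Section Fiber.
Variables (R : comNzRingType) (m a : set R) (hR : noetherian_local m).
Variables (p : nat -> nat) (A : forall i, 'M[R]_(p i.+1, p i)).
Hypothesis AA : forall i, A i.+1 *m A i = 0.
Local Notation tor_small := (tor_small A).
Hypothesis idm : ideal a.
Hypothesis tora : tor_small (a : set R^o) setT.

Lemma vec_split (I J : set R) q (u : 'rV[R]_q) :
  quasi_split m a I J -> vec m q u ->
  exists b c, [/\ vec I q b, vec J q c & u = b + c].
Proof.
move=> spl mu.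
have ex j : exists bc : R * R, [/\ I bc.1, J bc.2 & u 0 j = bc.1 + bc.2].
  by have [b [c [? ? ?]]] := split_max spl (mu j); exists (b, c).
have [f fP] := choice ex.
exists (\row_j (f j).1), (\row_j (f j).2); split=> [j|j|].
- by rewrite mxE; case: (fP j).
- by rewrite mxE; case: (fP j).
- by apply/rowP => j; rewrite !mxE; case: (fP j).
Qed.

(** A minimal cover of U / U0 by (R / a)^b; its kernel is small because the other two terms are. *)
Lemma minimal_cover s (U0 U : set 'rV[R]_s) :
  submod U0 -> submod U -> U0 `<=` U -> (forall r u, a r -> U u -> U0 (r *: u)) ->
  tor_small U0 U -> exists b (g : 'I_b -> 'rV[R]_s),
  [/\ forall i, U (g i), forall v, U v -> exists c, U0 (v - lc g c),
      [set c | U0 (lc g c)] `<=` vec m b, vec a b `<=` [set c | U0 (lc g c)]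
    & tor_small (vec a b) [set c | U0 (lc g c)]].
Proof.
move=> sU0 sU U0U aU TU; have [b0 [D DP]] := noetherian_rV (local_noetherian hR) sU.
have [|v|b [g [Ug genU ming]]] := @minimal_generators _ _ hR _ U0 U b0 (fun i => row i D) sU0.
- by move=> i; apply/DP/mxim_row.
- by move=> /DP[c ->]; exists c; rewrite lc_row subrr; case: sU0.
have aK : vec a b `<=` [set c | U0 (lc g c)].
  by move=> c ac; apply: submod_sum => // i _; apply: aU.
exists b, g; split=> //.
apply: (tor_small_sub AA (vec_submod b idm) (submod_preim (lc g) sU0) (@submodT _ _)) => //.
  by have := tor_small_vec b tora; rewrite (_ : vec setT b = setT) // -subTset.
apply/(tor_small_iso A (f := lc g) (U' := U0) (V' := U)) => //.
- by move=> c _; apply: submod_lc.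
- by move=> v /genU[c Uc]; exists c.
Qed.

(** The kernel of the minimal cover contains J^b, as J kills U / U0, and lies in m^b = I^b + J^b.
    Modulo a it is thus the direct sum of J^b and its part in I^b, and b > 0 since U / U0 is
    nonzero. *)
Lemma annihilated_tor_small (I J : set R) s (U0 U : set 'rV[R]_s) :
  quasi_split m a I J -> submod U0 -> submod U -> U0 `<=` U -> ~ (U `<=` U0) ->
  (forall r u, J r -> U u -> U0 (r *: u)) -> tor_small U0 U ->
  tor_small (a : set R^o) J.
Proof.
move=> spl sU0 sU U0U nUU0 JU TU.
have [r u ar Uu|b [g [Ug genU mK aK TK]]] := minimal_cover sU0 sU U0U _ TU.
  by apply: JU => //; apply: (split_subr spl).
case: b g Ug genU mK aK TK => [|b] g Ug genU mK aK TK.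
  case: nUU0 => v /genU[c]; by rewrite /lc big_ord0 subr0.
have [idI idJ] := (split_ideall spl, split_idealr spl).
have sK := submod_preim (lc g) sU0.
apply: (tor_small_component ord0 idm idJ).
apply: (tor_small_summand (V' := [set c | U0 (lc g c)] `&` vec I b.+1) _ _ _ _ _ _ _ _ TK).
- exact: vec_submod.
- exact: vec_submod.
- by apply: submodI => //; apply: vec_submod.
- by apply: vecS; apply: split_subr spl.
- by move=> c ac; split; [apply: aK|apply: vecS ac; apply: split_subl spl].
- by move=> c Jc; apply: submod_sum => // i _; apply: JU.
- move=> u Ku; have [b' [c [Ib Jc uE]]] := vec_split spl (mK _ Ku).
  exists c, b'; split=> //; last by rewrite addrC.
  split=> //; move: Ku; rewrite uE => Ku; apply: (submod_addr sK _ Ku).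
  by apply: submod_sum => // i _; apply: JU.
- by move=> c [Jc [_ Ic]] j; apply: (split_cap spl); split.
Qed.

(** J / a is a nonzero module killed by I, since I J lies in the intersection of I and J, hence in
    a. *)
Lemma swap_tor_small (I J : set R) :
  quasi_split m a I J -> tor_small (a : set R^o) J -> tor_small (a : set R^o) I.
Proof.
move=> spl TJ; have [idI idJ] := (split_ideall spl, split_idealr spl).
apply: (annihilated_tor_small (U0 := vec a 1) (U := vec J 1) (quasi_splitC spl)).
- exact: vec_submod.
- exact: vec_submod.
- by apply: vecS; apply: split_subr spl.
- move=> JU; apply: (split_neqr spl) => r Jr.
  have /JU/(_ 0) : vec J 1 (\row_j r) by move=> j; rewrite mxE.
  by rewrite mxE.
- move=> r u Ir Ju j; rewrite mxE; apply: (split_cap spl); split.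
    by rewrite mulrC; case: idI => _ _; apply.
  by case: idJ => _ _; apply.
- exact: tor_small_vec.
Qed.

(** As m / J is isomorphic to I / a, the module m / a is an extension of small modules, and k is the
    quotient of R / a by it. *)
Lemma residue_tor_small (I J : set R) : quasi_split m a I J ->
  tor_small (a : set R^o) I -> tor_small (a : set R^o) J ->
  tor_small (m : set R^o) setT.
Proof.
move=> spl TI TJ; have [idI idJ] := (split_ideall spl, split_idealr spl).
have idmm := local_ideal hR.
have am : a `<=` m by move=> r /(split_subl spl)/(split_maxl spl).
apply: (tor_small_quot AA (U := (a : set R^o)) idm idmm (@submodT _ _)) => //.
apply: (tor_small_ext AA (V := (J : set R^o)) idm idJ idmm) => //.
- exact: split_subr spl.
- exact: split_maxr spl.
have idL : linear (fun x : R^o => x) by [].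
have [f fE] := linear_of_fun idL.
apply/(tor_small_iso A (f := f) (U := (a : set R^o)) (V := (I : set R^o))
  (U' := (J : set R^o)) (V' := (m : set R^o))) => //.
- by move=> r Ir; rewrite fE; apply: split_maxl spl _ Ir.
- move=> r /(split_max spl)[i [j [Ii Jj ->]]]; exists i.
  by rewrite fE addrC addKr.
- move=> r Ir; rewrite fE; split; first by apply: split_subr spl _.
  by move=> Jr; apply: (split_cap spl).
Qed.

(* [K] is a second syzygy over the fiber product ring R / a. *)
Lemma second_syzygy_tor_small (I J : set R) q s (Phi : 'M[R]_(q, s)) :
  quasi_split m a I J -> (forall i j, m (Phi i j)) ->
  let K := [set c | vec a s (c *m Phi)] in
  K `<=` vec m q -> ~ (K `<=` vec a q) -> tor_small (vec a q) K ->
  tor_small (m : set R^o) setT.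
Proof.
move=> spl mPhi K mK naK TK; have [idI idJ] := (split_ideall spl, split_idealr spl).
have sa := vec_submod s idm.
have sK : submod K := submod_preim (mulmxr Phi) sa.
have aK : vec a q `<=` K by move=> c ac; apply: vec_mulmx.
(* The part of [K] in I' is killed by J', and it is a direct summand of [K] modulo a; if it is
   nonzero, J' is small. *)
have half (I' J' : set R) : quasi_split m a I' J' ->
    (exists u, K u /\ vec I' q u /\ ~ vec a q u) ->
    (K `<=` submod_sumset (K `&` vec I' q) (K `&` vec J' q)) ->
    tor_small (a : set R^o) J'.
  move=> spl' [u [Ku [Iu nau]]] Ksum.
  have [idI' idJ'] := (split_ideall spl', split_idealr spl').
  have sKI : submod (K `&` vec I' q) by apply: submodI => //; apply: vec_submod.
  apply: (annihilated_tor_small (U0 := vec a q) (U := K `&` vec I' q) spl') => //.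
  - exact: vec_submod.
  - by move=> c ac; split; [apply: aK|apply: vecS ac; apply: split_subl spl'].
  - by move=> sub; apply: nau; apply: sub.
  - move=> r c Jr [_ Ic] j; rewrite mxE; apply: (split_cap spl'); split.
      by case: idI' => _ _; apply.
    by rewrite mulrC; case: idJ' => _ _; apply.
  - apply: (tor_small_summand (V' := K `&` vec J' q) _ _ _ _ _ _ _ _ TK) => //.
    + exact: (vec_submod q idm).
    + exact: (submodI sK (vec_submod q idJ')).
    + by move=> c ac; split; [apply: aK|apply: vecS ac; apply: split_subl spl'].
    + by move=> c ac; split; [apply: aK|apply: vecS ac; apply: split_subr spl'].
    + by move=> c [[_ Ic] [_ Jc]] j; apply: (split_cap spl').
have Ksum : K `<=` submod_sumset (K `&` vec I q) (K `&` vec J q).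
  move=> u Ku; have [b [c [Ib Jc uE]]] := vec_split spl (mK _ Ku).
  (* The entries of b Phi lie in I because those of b do, and in J because b Phi = u Phi - c Phi
     with u Phi in a. *)
  have Kb : K b.
    move=> j; apply: (split_cap spl); split; first exact: vec_mulmx.
    have -> : b *m Phi = u *m Phi - c *m Phi by rewrite -mulmxBl uE addrK.
    have := @submodB _ _ (vec J s) (u *m Phi) (c *m Phi) (vec_submod s idJ).
    by apply; [apply: vecS Ku; apply: split_subr spl|apply: vec_mulmx].
  exists b, c; split=> //; split=> //; move: Ku; rewrite uE addrC => Ku.
  exact: (submod_addr sK Kb Ku).
have Ksum' : K `<=` submod_sumset (K `&` vec J q) (K `&` vec I q).
  by move=> u /Ksum[b [c [? ? ->]]]; exists c, b; rewrite addrC.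
have [u [Ku nau]] : exists u, K u /\ ~ vec a q u.
  apply: contrapT => nu; apply: naK => u Ku; apply: contrapT => nau.
  by apply: nu; exists u.
have [b [c [[Kb Ib] [Kc Jc] uE]]] := Ksum _ Ku.
have [ab|nab] := pselect (vec a q b).
  have nac : ~ vec a q c.
    by move=> ac; apply: nau; rewrite uE; case: (vec_submod q idm) => _ + _; apply.
  have TI : tor_small (a : set R^o) I.
    by apply: (half _ _ (quasi_splitC spl) _ Ksum'); exists c.
  by apply: (residue_tor_small spl TI); apply: (swap_tor_small (quasi_splitC spl)).
have TJ : tor_small (a : set R^o) J by apply: (half _ _ spl _ Ksum); exists b.
by apply: (residue_tor_small spl _ TJ); apply: (swap_tor_small spl).
Qed.

(** The matrices vanish modulo m, so the Tor of k in degree i is k^(p i), and its vanishing forces p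
    i = 0. *)
Lemma residue_tor_small_finite :
  (forall i b c, m (A i b c)) -> tor_small (m : set R^o) setT ->
  exists i0, forall i, (i0 <= i)%N -> p i = 0%N.
Proof.
move=> mA [i0 TI]; exists i0.+1 => -[//|i]; rewrite ltnS => /TI exi.
have idmm := local_ideal hR.
have mact k l (B : 'M_(k, l)) (z : 'I_k -> R^o) b :
    (forall i j, m (B i j)) -> m (act B z b).
  move=> mB; apply: (submod_sum (M := R^o)) => // c _.
  by rewrite /GRing.scale /= mulrC; case: idmm => _ _; apply.
case: (posnP (p i.+1)) => // p0.
have [//|b|w [_ /(_ (Ordinal p0)) mw]] := exi (fun=> 1 : R^o).
  exact: mact.
case: (local_not1 hR); apply: (submod_subr (M := R^o) idmm _ mw).
exact: mact.
Qed.

End Fiber.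

(** * Vanishing of minimal syzygies of small modules *)

Section QuasiFiber.
Variables (R : comNzRingType) (m : set R) (hR : noetherian_local m).
Variables (x : nat -> R) (n : nat) (I J : set R).
Local Notation a := (reg_smul x (setT : set R^o) n).
Hypothesis xm : forall i, (i < n)%N -> m (x i).
Hypothesis regR : regular_upto x (setT : set R^o) n.
Hypothesis spl : quasi_split m a I J.
Variables (p : nat -> nat) (A : forall i, 'M[R]_(p i.+1, p i)).
Hypothesis AA : forall i, A i.+1 *m A i = 0.
Local Notation tor_small := (tor_small A).
Hypothesis torR : tor_small ([set 0] : set R^o) setT.
Hypothesis ntork : ~ tor_small (m : set R^o) setT.
Local Notation syzygy_like := (syzygy_like x A n).

Let ida : ideal a. Proof. exact: reg_smul_ideal. Qed.
Let am : a `<=` m.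
Proof. by move=> r /(split_subl spl)/(split_maxl spl). Qed.
Let tora : tor_small (a : set R^o) setT.
Proof. exact: (tor_small_reg_smul AA (submodT _) regR). Qed.

Lemma syzygy_like0 q s (D : 'M[R]_(q, s)) : tor_small (mxim D) setT -> syzygy_like 0 D.
Proof.
move=> TD; split.
  apply: (tor_small_sub AA (submod0 _) (mxim_submod D) (@submodT _ _)) => //.
    by move=> _ ->; case: (mxim_submod D).
  exact: tor_small_rV.
by case=> [|//] _ _ u.
Qed.

Lemma mxim_nakayama q s (D : 'M[R]_(q, s)) :
  mxim D `<=` reg_smul x (mxim D) n -> D = 0.
Proof.
move=> DD; have D0 : forall u, mxim D u -> u = 0.
  apply: (nakayama hR (g := fun i => row i D)) => [|i|_ [v ->]|u /DD].
  - exact: mxim_submod.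
  - exact: mxim_row.
  - by exists v; rewrite lc_row.
  move=> /reg_smul_sum[|v [Dv ->]]; first by case: (mxim_submod D).
  exists n, (fun i => v i), (\row_i x i); split=> [//|i|].
    by rewrite mxE; apply: xm.
  by apply: eq_bigr => i _; rewrite mxE.
by apply/row_matrixP => i; rewrite row0; apply/D0/mxim_row.
Qed.

Section SyzygyModuloSequence.
Variables (q s : nat) (D : 'M[R]_(q, s)).
Hypothesis mD : forall i j, m (D i j).
Hypothesis synD : syzygy_like n D.

Let sL : submod (mxim D). Proof. exact: mxim_submod. Qed.

Let Lm : mxim D `<=` vec m s.
Proof. by move=> _ [v ->]; apply: vec_mulmxr => //; apply: local_ideal. Qed.

(** This embeds L / (x) L into (R / a)^s, where L = im D. *)
Lemma mxim_cap u : mxim D u -> reg_smul x (mxim D) n u <-> vec a s u.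
Proof.
move=> Du; split=> [Iu|au].
  by apply/reg_smul_vec; apply: reg_smul_mono Iu.
by case: synD => _; apply=> //; apply/reg_smul_vec.
Qed.

Lemma tor_small_mxim : tor_small (reg_smul x (mxim D) n) (mxim D).
Proof.
case: (synD) => TD _; apply: (tor_small_reg_smul (n := n) AA sL _ TD) => //.
by apply: (syzygy_like_regular regR synD); rewrite ?leqW.
Qed.

(** The minimal cover (R / a)^b -> L / (x) L of L = im D has kernel { c : c Phi = 0 }, with the
    entries of Phi in m. If b > 0, the kernel contains z e_0, which is nonzero modulo a, and k would
    be small. If b = 0, then L = (x) L and Nakayama applies. *)
Lemma socle_syzygy_eq0 z : ~ a z -> (forall r, m r -> a (r * z)) -> D = 0.
Proof.
move=> naz mz; have sU0 := reg_smul_submod x n sL.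
have [||b [g [Lg genL mK aK TK]]] :=
    minimal_cover hR AA ida tora sU0 sL _ _ tor_small_mxim.
- exact: reg_smul_sub.
- move=> r u ar Du.
  have fL : linear (fun r : R^o => (r : R) *: u) by move=> c y y'; rewrite scalerDl scalerA.
  have [f fE] := linear_of_fun fL; rewrite -(fE r).
  by apply: reg_smul_linear ar => y _; rewrite fE; case: sL => _ _; apply.
case: b g Lg genL mK aK TK => [|b] g Lg genL mK aK TK.
  by apply: mxim_nakayama => u /genL[c]; rewrite /lc big_ord0 subr0.
case: ntork.
pose Phi := \matrix_i g i.
have PhiE c : c *m Phi = lc g c.
  by rewrite -lc_row; apply: eq_bigr => i _; rewrite rowK.
have mPhi i j : m (Phi i j) by rewrite mxE; apply: Lm.
have KE : [set c | vec a s (c *m Phi)] = [set c | reg_smul x (mxim D) n (lc g c)].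
  by apply/seteqP; split=> c /=; rewrite PhiE => /mxim_cap; apply; apply: submod_lc.
apply: (second_syzygy_tor_small hR AA ida tora spl mPhi); rewrite KE //.
have ze : vec a s ((z *: delta_mx 0 0) *m Phi).
  move=> j; rewrite -scalemxAl -rowE rowK mxE mulrC; apply: mz; exact: Lm.
move=> KK; apply: naz; have := KK (z *: delta_mx 0 0).
rewrite -KE => /(_ ze)/(_ 0); by rewrite !mxE !eqxx mulr1.
Qed.

(** The second syzygy over R / a is now taken with Phi = D itself: K / a R^q is isomorphic to L' /
    (x) L' with L' = im D', which is small. So K = a R^q, that is L' = (x) L', and Nakayama
    applies. *)
Lemma next_syzygy_eq0 r (D' : 'M[R]_(r, q)) : (forall i j, m (D' i j)) ->
  (forall u, u *m D = 0 <-> mxim D' u) -> D' = 0.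
Proof.
move=> mD' kerD; have synD' := syzygy_like_step AA regR torR kerD synD.
have sL' := mxim_submod D'.
have cap u : mxim D' u -> reg_smul x (mxim D') n u <-> vec a q u.
  move=> Du; split=> [Iu|au].
    by apply/reg_smul_vec; apply: reg_smul_mono Iu.
  by case: synD' => _; apply=> //; apply/reg_smul_vec.
pose K := [set u | vec a s (u *m D)].
have sK : submod K := submod_preim (mulmxr D) (vec_submod s ida).
have L'K : mxim D' `<=` K.
  by move=> u /kerD D0 j; rewrite D0 mxE; case: ida.
(* u D lies in (x) im D, hence equals w D with w in (x) R^q, and u - w is in ker D = im D'. *)
have KL' u : K u -> exists v, mxim D' v /\ vec a q (u - v).
  move=> Ku; have /(reg_smul_lift (f := mulmxr D) (Z := setT))[|w [Iw wE]] :
      reg_smul x (mxim D) n (u *m D) by apply/mxim_cap => //; exists u.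
    by move=> _ [z ->]; exists z.
  exists (u - w); split; first by apply/kerD; rewrite mulmxBl -wE subrr.
  by rewrite subKr; apply/reg_smul_vec.
have [K0|nK0] := pselect (K `<=` vec a q).
  by apply: mxim_nakayama => u Du; apply/cap => //; apply/K0/L'K.
case: ntork; apply: (second_syzygy_tor_small hR AA ida tora spl mD) => // [u Ku|].
  have [v [Dv av]] := KL' u Ku.
  apply: (submod_subr (vec_submod q (local_ideal hR)) _ (vecS am av)).
  by case: Dv => y ->; apply: vec_mulmxr => //; apply: local_ideal.
have idL : linear (fun u : 'rV[R]_q => u) by [].
have [f fE] := linear_of_fun idL.
apply/(tor_small_iso A (f := f) (U := reg_smul x (mxim D') n) (V := mxim D')) => //.
- exact: vec_submod.
- by move=> u /L'K; rewrite fE.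
- by move=> u /KL'[v [Dv av]]; exists v; rewrite fE.
- by move=> u Du; rewrite fE; apply: cap.
case: (synD') => TD' _; apply: (tor_small_reg_smul (n := n) AA sL' _ TD') => //.
by apply: (syzygy_like_regular regR synD'); rewrite ?leqW.
Qed.

End SyzygyModuloSequence.

Lemma minimal_resolution_stops (q : nat -> nat) (D : forall i, 'M[R]_(q i.+1, q i)) :
  (forall i b c, m (D i b c)) ->
  (forall i u, u *m D i = 0 <-> mxim (D i.+1) u) ->
  tor_small (mxim (D 0%N)) setT -> D n.+1 = 0.
Proof.
move=> mD exD TD.
have syn k : syzygy_like k (D k).
  elim: k => [|k IHk]; first exact: syzygy_like0.
  exact: (syzygy_like_step AA regR torR (exD k) IHk).
exact: (next_syzygy_eq0 (mD n) (syn n)).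
Qed.

End QuasiFiber.

(** * A resolution of the residue field *)

Lemma mulmx_ker_lift (R : comNzRingType) k p q r (X : 'M[R]_(k, q)) (D : 'M[R]_(q, p))
    (D' : 'M[R]_(r, q)) :
  (forall u, u *m D = 0 -> mxim D' u) -> X *m D = 0 -> exists H, X = H *m D'.
Proof.
move=> kerD XD; have ex i : exists h, row i X = h *m D'.
  by apply: kerD; rewrite -row_mul XD row0.
have [h hP] := choice ex.
exists (\matrix_i h i); apply/row_matrixP => i.
by rewrite row_mul rowK.
Qed.

Lemma act_scalar (R : comNzRingType) (M : lmodType R) p c (z : 'I_p -> M) b :
  act c%:M z b = c *: z b.
Proof.
rewrite /act (bigD1 b) //= !mxE eqxx big1 ?addr0 // => a ab.
by rewrite !mxE (negPf ab) scale0r.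
Qed.

Lemma act_addmx (R : comNzRingType) (M : lmodType R) p q (A B : 'M[R]_(p, q))
    (z : 'I_p -> M) b :
  act (A + B) z b = act A z b + act B z b.
Proof. by rewrite /act -big_split; apply: eq_bigr => a _; rewrite mxE scalerDl. Qed.

Section ResidueField.
Variables (R : comNzRingType) (m : set R) (hR : noetherian_local m).

(* The augmentation P_0 = R -> k shows up as [exact_at B 0] failing on R, hence
   the extra zero term of the complex in degree 0. *)
Lemma residue_resolution : exists (p : nat -> nat) (B : forall i, 'M[R]_(p i.+1, p i)),
  [/\ forall i, B i.+1 *m B i = 0,
      forall i u, u *m B i.+1 = 0 -> mxim (B i.+2) u,
      forall i c, m c -> exists G H, H *m B i.+1 + B i *m G = c%:M
    & ~ exact_at B 0 ([set 0] : set R^o) setT].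
Proof.
have idm := local_ideal hR.
have [q [A0 [A [A0P A00 Aex mA]]]] := minimal_resolution hR (vec_submod 1 idm).
(* The ranks are 0, 1, q 0, q 1, ...: [B 0] is an empty 1 by 0 matrix and [B 1] is [A0], whose rows
   generate m. *)
pose A' := cons_mx A0 A; pose p := cons_dim 0 (cons_dim 1 q).
pose B : forall i, 'M[R]_(p i.+1, p i) := cons_mx (q := cons_dim 1 q) 0 A'.
have Bex i u : u *m B i.+1 = 0 <-> mxim (B i.+2) u.
  by case: i u => [|i] u; [apply: A00|apply: Aex].
have BB i : B i.+1 *m B i = 0.
  case: i => [|i]; first by rewrite /= mulmx0.
  by apply/row_matrixP => a; rewrite row_mul row0; apply/Bex/mxim_row.
exists p, B; split=> // [i u /Bex//|i c mc|ex0].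
(* Since c kills k, multiplication by c is null-homotopic; the homotopy is built degree by
   degree. *)
- elim: i => [|i [G [H GH]]].
    have ex (i : 'I_1) : exists h, row i c%:M = h *m A0.
      by apply/A0P => j; rewrite !mxE mulrb; case: (i == j) => //; case: idm.
    have [h hP] := choice ex.
    exists 0, (\matrix_i h i : 'M[R]_(p 1%N, p 2%N)).
    rewrite mulmx0 addr0; apply/row_matrixP => i.
    by rewrite row_mul rowK -hP.
  have [|H' H'E] := mulmx_ker_lift (X := c%:M - B i.+1 *m H) (fun u => (Bex i u).1).
    rewrite mulmxBl -mulmxA -[H *m _](addrK (B i *m G)) GH mulmxBr mulmxA BB mul0mx.
    by rewrite subr0 scalar_mxC subrr.
  by exists H, H'; rewrite -H'E subrK.
- have [//|[]//|w [_ /(_ 0)]] := ex0 (fun=> 1 : R^o).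
  move=> /eqP; rewrite subr_eq0 => /eqP w1; apply: (local_not1 hR); rewrite w1.
  apply: (submod_sum (M := R^o)) => // a _; rewrite /GRing.scale /= mulrC.
  have /A0P/(_ 0) : mxim A0 (row a A0) by apply: mxim_row.
  by rewrite mxE; case: idm => _ _; apply.
Qed.

Variables (p : nat -> nat) (B : forall i, 'M[R]_(p i.+1, p i)).
Hypothesis BB : forall i, B i.+1 *m B i = 0.
Hypothesis Bex : forall i u, u *m B i.+1 = 0 -> mxim (B i.+2) u.
Hypothesis homotopy : forall i c, m c -> exists G H, H *m B i.+1 + B i *m G = c%:M.

(* As c kills the homology of (p, B), multiplication by c on M / U gives a
   surjective connecting map H_(i+1)(M / (U + cM)) -> H_i(M / U). *)
Lemma exact_at_regular (M : lmodType R) (y : nat -> R) k i : m (y k) ->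
  (forall u : M, reg_smul y setT k (y k *: u) -> reg_smul y setT k u) ->
  exact_at B i.+1 (reg_smul y (setT : set M) k.+1) setT ->
  exact_at B i (reg_smul y (setT : set M) k) setT.
Proof.
move=> myk regk ex z _ Uz; set U := reg_smul y _ k in regk Uz *.
have sU : submod U := reg_smul_submod y k (@submodT _ M).
have sU' := reg_smul_submod y k.+1 (@submodT _ M).
have UU' : U `<=` reg_smul y setT k.+1 by apply: reg_smulS.
have [G [H GH]] := homotopy i myk.
have yz b : U (y k *: z b - act (B i.+1) (act H z) b).
  rewrite -act_scalar -GH act_addmx act_comp addrAC subrr add0r -act_comp.
  exact: act_submod.
have [//|b|v [_ Uv]] := ex (act H z).
  have zU' : reg_smul y setT k.+1 (y k *: z b).
    by exists 0, (z b); rewrite add0r; split=> //; case: sU.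
  by apply: (submod_subr sU' zU'); apply: submodBC => //; apply/UU'/yz.
(* Here H z = B v + t + y_k u with t in [U]. Applying [B i.+1] kills B v, so y_k (z - B u) lies in
   [U], and y_k can be cancelled. *)
have [t tP] := choice Uv; have [u uP] := choice tP.
exists u; split=> // b; apply: regk.
have tE : act (B i.+1) (act H z) b = act (B i.+1) t b + y k *: act (B i.+1) u b.
  rewrite -[LHS]subr0 -(act_act BB v b) -actB /act scaler_sumr -big_split.
  apply: eq_bigr => a _ /=; have [_ _ ->] := uP a.
  by rewrite scalerDr !scalerA mulrC.
have -> : y k *: (z b - act (B i.+1) u b) =
    y k *: z b - act (B i.+1) (act H z) b + act (B i.+1) t b.
  by rewrite tE scalerBr opprD addrA addrAC subrK.
have [_ UD _] := sU; apply: UD => //; apply: act_submod => // a.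
by case: (uP a).
Qed.

End ResidueField.

(** * The bound n + 1 on the length of regular sequences *)

Section Depth.
Variables (R : comNzRingType) (m : set R) (hR : noetherian_local m).
Variables (x : nat -> R) (n : nat) (I J : set R).
Hypothesis xm : forall i, (i < n)%N -> m (x i).
Hypothesis regR : regular_upto x (setT : set R^o) n.
Hypothesis spl : quasi_split m (reg_smul x (setT : set R^o) n) I J.
Variables (p : nat -> nat) (A : forall i, 'M[R]_(p i.+1, p i)).
Hypothesis AA : forall i, A i.+1 *m A i = 0.
Hypothesis torR : tor_small A ([set 0] : set R^o) setT.
Hypothesis ntork : ~ tor_small A (m : set R^o) setT.

(* R / (y) has projective dimension at most n + 1, whereas Tor_r(k, R / (y)) <> 0. *)
Lemma regular_length_bound (y : nat -> R) r :
  (forall i, (i < r)%N -> m (y i)) -> regular_upto y (setT : set R^o) r -> (r <= n.+1)%N.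
Proof.
move=> ym regy; rewrite leqNgt; apply/negP => nr.
have idm := local_ideal hR.
pose b := reg_smul y (setT : set R^o) r.
have idb : ideal b := reg_smul_ideal y r.
have bm : b `<=` m.
  move=> u /reg_smul_sum[//|v [_ ->]]; apply: (submod_sum (M := R^o)) => // i _.
  by rewrite /GRing.scale /= mulrC; case: idm => _ _; apply; apply: ym.
have [q [D0 [D [D0P D00 Dex mD]]]] := minimal_resolution hR (vec_submod 1 idb).
pose F := cons_mx D0 D.
have D0E : mxim D0 = vec b 1 by apply/seteqP; split=> u /D0P.
have mF i c d : m (F i c d).
  case: i c d => [|i] c d; last exact: mD.
  have /D0P/(_ d) : mxim D0 (row c D0) by apply: mxim_row.
  by rewrite mxE => /bm.
have Fex i u : u *m F i = 0 <-> mxim (F i.+1) u.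
  by case: i u => [|i] u; [apply: D00|apply: Dex].
have F0 : F n.+1 = 0.
  apply: (minimal_resolution_stops hR xm regR spl AA torR ntork mF Fex).
  rewrite [mxim _]D0E (_ : setT = vec setT 1); last by apply/esym; rewrite -subTset.
  apply: tor_small_vec.
  exact: (tor_small_reg_smul AA (submodT _) regy torR).
have [p' [B [BB Bex homot nB0]]] := residue_resolution hR.
(* Because of the extra term in degree 0, [exact_at B j] is the vanishing of Tor_j(k, -). Starting
   from F_(n+1) = 0, dimension shifting gives Tor_j(k, im F_i) = 0 for j >= n + 1 - i. *)
have vanish l i : (i + l = n.+1)%N -> forall j, (l <= j)%N ->
    exact_at B j [set 0] (mxim (F i)).
  elim: l i => [|l IHl] i.
    rewrite addn0 => -> j _ z zF _; exists (fun=> 0); split=> a.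
      by case: (mxim_submod (F n.+1)).
    have [v ->] := zF a; rewrite F0 mulmx0 sub0r.
    by rewrite /act big1 ?oppr0 // => c _; rewrite scaler0.
  rewrite addnS -addSn => il [//|j]; rewrite ltnS => lj.
  apply/(exact_at_mxim _ _ (Fex i)).
  apply: (exact_at_quot BB (submod0 _) (mxim_submod _) (@submodT _ _)) => //.
  - by move=> _ ->; case: (mxim_submod (F i.+1)).
  - exact: IHl il _ lj.
  - exact/exact_at_rV/exact_at_free/Bex.
(* Tor_r(k, R / b) vanishes because Tor_(r-1)(k, b) does, as r - 1 >= n + 1. *)
have exr : exact_at B r b setT.
  have r'E : r = r.-1.+1 by rewrite prednK // (leq_trans _ nr).
  rewrite [X in exact_at _ X]r'E.
  apply: (@exact_at_component _ _ _ _ _ 1 0 _ idb); first by split.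
  rewrite -D0E (_ : vec setT 1 = setT); last by rewrite -subTset.
  apply: (exact_at_quot BB (submod0 _) (mxim_submod D0) (@submodT _ _)) => //.
  - by move=> _ ->; case: (mxim_submod D0).
  - by apply: (vanish n.+1 0%N) => //; rewrite -ltnS -r'E.
  - exact/exact_at_rV/exact_at_free/Bex.
(* Removing the elements of y one at a time leads down to Tor_0(k, R) = 0, which is false. *)
apply: nB0; have desc l : (l <= r)%N -> exact_at B l (reg_smul y (setT : set R^o) l) setT ->
    exact_at B 0 ([set 0] : set R^o) setT.
  elim: l => [//|l IHl] lr ex; apply: IHl; first exact: ltnW.
  by apply: (exact_at_regular BB homot _ _ ex); [apply: ym|move=> u; apply: regy].
exact: desc exr.
Qed.

End Depth.

(** * Prime avoidance: a regular element or a socle element modulo a *)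

Section PrimeAvoidance.
Variables (R : comNzRingType) (m a : set R).
Hypotheses (noethR : noetherian R) (idm : ideal m) (ida : ideal a).

Definition colon z : set R := [set r | a (r * z)].

Lemma colon_ideal z : ideal (colon z).
Proof.
have [a0 aD aM] := ida; split=> [|r s ar as_|c r ar]; rewrite /colon /=.
- by rewrite mul0r.
- by rewrite mulrDl; apply: aD.
- by rewrite -mulrA; apply: aM.
Qed.

(** Then [colon z] is an associated prime of R / a. *)
Definition maximal_colon z : Prop :=
  ~ a z /\ forall z', ~ a z' -> colon z `<=` colon z' -> colon z' `<=` colon z.

Lemma maximal_colon_exists z : ~ a z -> exists z', maximal_colon z' /\ colon z `<=` colon z'.
Proof.
move=> naz; pose F := [set K | exists z', [/\ ~ a z', colon z `<=` K & K = colon z']].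
have [||K [[z' [naz' zz' KE]] max]] := @noetherian_maximal _ noethR F (colon z).
- by move=> _ [z' [_ _ ->]]; apply: colon_ideal.
- by exists z; split.
subst K; exists z'; split=> //; split=> // z'' naz'' z'z''.
by apply: max => //; exists z''; split=> //; apply: subset_trans z'z''.
Qed.

(** If s z is not in a, then [colon (s * z)] contains [colon z], so both are equal by maximality,
    and the first contains r. *)
Lemma maximal_colon_prime z r s :
  maximal_colon z -> colon z (r * s) -> ~ colon z s -> colon z r.
Proof.
move=> [naz max] ars nas; apply: (max (s * z)) => //.
  by move=> t; rewrite /colon /= mulrCA; case: ida => _ _; apply.
by rewrite /colon /= mulrA.
Qed.

(** [t] is a product of elements of the ideals [colon z'] outside the prime [colon z]. *)
Lemma colon_avoid z w (l : seq R) : maximal_colon z -> ~ colon z w ->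
  (forall z', z' \in l -> ~ (colon z' `<=` colon z)) ->
  exists t, [/\ ~ colon z (t * w) & forall z', z' \in l -> colon z' t].
Proof.
move=> maxz nw; elim: l => [|z' l IHl] nl; first by exists 1; rewrite mul1r.
have [|t [nt lt]] := IHl; first by move=> y yl; apply: nl; rewrite inE yl orbT.
have [s [z's nzs]] : exists s, colon z' s /\ ~ colon z s.
  apply: contrapT => ns; apply: (nl z'); first by rewrite inE eqxx.
  by move=> s z's; apply: contrapT => nzs; apply: ns; exists s.
exists (s * t); split=> [|y]; first by rewrite -mulrA => /maximal_colon_prime -/(_ maxz nt).
rewrite inE => /predU1P[->|yl]; first by rewrite mulrC; case: (colon_ideal z') => _ _; apply.
by case: (colon_ideal y) => _ _; apply; apply: lt.
Qed.

(** Without a socle element no associated prime of R / a contains m, and avoiding finitely many of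
    them suffices. *)
Lemma regular_or_socle :
  (exists y, m y /\ forall u, a (y * u) -> a u) \/
  (exists z, ~ a z /\ forall r, m r -> a (r * z)).
Proof.
have [?|nosocle] := pselect (exists z, ~ a z /\ forall r, m r -> a (r * z)); first by right.
left.
have {}nosocle z : ~ a z -> exists w, m w /\ ~ colon z w.
  move=> naz; apply: contrapT => nw; apply: nosocle; exists z; split=> // r mr.
  by apply: contrapT => nr; apply: nw; exists r.
have avoid (l : seq R) : (forall z, z \in l -> maximal_colon z) ->
    exists y, m y /\ forall z, z \in l -> ~ colon z y.
  elim: l => [|z l IHl] maxl; first by exists 0; split=> //; case: idm.
  have [|y [my ly]] := IHl; first by move=> z' z'l; apply: maxl; rewrite inE z'l orbT.
  have maxz : maximal_colon z by apply: maxl; rewrite inE eqxx.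
  have [zy|nzy] := pselect (colon z y); last first.
    by exists y; split=> // z'; rewrite inE => /predU1P[->//|]; apply: ly.
  have [w [mw nzw]] := nosocle z maxz.1.
  have [z' z'l z'z|t [ntw lt]] := colon_avoid (l := l) maxz nzw.
    have [_ maxz'] : maximal_colon z' by apply: maxl; rewrite inE z'l orbT.
    by apply: (ly z') => //; exact: (maxz' z maxz.1).
  (* t w is outside [colon z], which contains y, and inside the other ideals, which avoid y. *)
  exists (y + t * w); split=> [|z'].
    by case: idm => _ mD mM; apply: mD => //; apply: mM.
  rewrite inE => /predU1P[->|z'l] yt.
    apply: ntw; move: yt; rewrite addrC.
    exact: (submod_addr (M := R^o) (colon_ideal z) zy).
  apply: (ly z') => //; apply: (submod_addr (M := R^o) (colon_ideal z') _ yt).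
  by rewrite mulrC; case: (colon_ideal z') => _ _; apply; apply: lt.
(* This replaces the finiteness of the set of associated primes: among finite lists of elements with
   maximal colon, one with maximal span contains all such elements in its span. *)
pose span (l : seq R) : set R :=
  [set r | forall K : set R, ideal K -> (forall z, z \in l -> K z) -> K r].
have span_ideal l : ideal (span l).
  split=> [K [K0 _ _] _//|r s rl sl K idK Kl|c r rl K idK Kl].
    by have [_ KD _] := idK; apply: KD; [apply: rl|apply: sl].
  by have [_ _ KM] := idK; apply: KM; apply: rl.
pose F := [set K | exists2 l, (forall z, z \in l -> maximal_colon z) & K = span l].
have [||K [[l maxl KE] max]] := @noetherian_maximal _ noethR F (span [::]).
- by move=> _ [l _ ->].
- by exists [::].
subst K; have [y [my ly]] := avoid l maxl; exists y; split=> // u ayu; apply: contrapT => nau.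
have [z [maxz uz]] := maximal_colon_exists nau.
have zl : span l z.
  apply: (max (span (z :: l))) => [|r rl K idK Kzl|K _ Kzl].
  - by exists (z :: l) => // z'; rewrite inE => /predU1P[->//|]; apply: maxl.
  - by apply: rl => // z' z'l; apply: Kzl; rewrite inE z'l orbT.
  - by apply: Kzl; rewrite inE eqxx.
have [|z' z'l z'z|t [nt lt]] := @colon_avoid z 1 l maxz.
- by rewrite /colon /= mul1r; apply: maxz.1.
- have [_ maxz'] := maxl z' z'l; apply: (ly z') => //.
  by apply: (maxz' z maxz.1 z'z); apply: uz.
(* t multiplies every element of [l] into a, hence also z, which lies in the span of [l]. *)
apply: nt; rewrite mulr1; apply: (zl [set s | a (t * s)]) => //.
split=> [|r s ar as_|c r ar] /=.
- by rewrite mulr0; case: ida.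
- by rewrite mulrDr; case: ida => _ + _; apply.
- by rewrite mulrCA; case: ida => _ _; apply.
Qed.

End PrimeAvoidance.

(** * Ext and Tor computed from a resolution by matrices *)

Section MatrixResolution.
Variables (R : comNzRingType) (M : lmodType R) (p : nat -> nat).
Variables (A : forall i, 'M[R]_(p i.+1, p i)) (g : 'I_(p 0%N) -> M).
Hypothesis g_surj : surjective (lc g).
Hypothesis g_ker : forall u, lc g u = 0 <-> mxim (A 0%N) u.
Hypothesis Aex : forall i u, u *m A i = 0 <-> mxim (A i.+1) u.

Lemma projective_rV n : projective 'rV[R]_n.
Proof.
move=> X Y h f h_surj; have [w wP] := choice (fun i => h_surj (f (delta_mx 0 i))).
have [k kE] := linear_of_fun (lc_is_linear w).
exists k => u; rewrite kE linear_lc [in RHS](row_sum_delta u) linear_sum.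
by apply: eq_bigr => i _; rewrite /= wP linearZ.
Qed.

(** Kept transparent so that the differentials reduce to multiplication by [A i]. *)
Definition matrix_resolution : proj_resolution M.
Proof.
refine (@ProjResolution R M (fun i => 'rV[R]_(p i)) (fun i => mulmxr (A i)) (lc g)
  (fun i => @projective_rV (p i)) g_surj _ _).
- by move=> u; split=> [/g_ker[v ->]|[v <-]]; [exists v|apply/g_ker; exists v].
- by move=> i u; split=> [/Aex[v ->]|[v <-]]; [exists v|apply/Aex; exists v].
Defined.

Lemma pd_le_matrix i0 : (forall i, (i0 <= i)%N -> p i = 0%N) -> pd_le M i0.
Proof.
move=> p0; exists matrix_resolution => i i0i u; apply/rowP => j.
by have := ltn_ord j; rewrite {2}p0 // ltnW.
Qed.

Lemma lc_mulmx (N : lmodType R) q s (z : 'I_s -> N) (D : 'M[R]_(q, s)) u :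
  lc z (u *m D) = lc (act D^T z) u.
Proof.
rewrite /lc /act; under eq_bigr do rewrite mxE scaler_suml.
rewrite exchange_big; apply: eq_bigr => c _; rewrite scaler_sumr.
by apply: eq_bigr => b _; rewrite scalerA mxE.
Qed.

(** A linear map R^p -> N is a p-tuple in N, and composing it with a matrix is the action of the
    transpose. *)
Lemma Ext_vanishes_act (N : lmodType R) j (z : 'I_(p j.+1) -> N) :
  Ext_vanishes j.+1 M N -> (forall c, act (A j.+1)^T z c = 0) ->
  exists w, forall b, z b = act (A j)^T w b.
Proof.
move=> ext z0; have [f fE] := linear_of_fun (lc_is_linear z).
have [u|h hP] := ext matrix_resolution f.
  by rewrite fE /= lc_mulmx /lc big1 // => c _; rewrite z0 scaler0.
exists (fun c => h (delta_mx 0 c)) => b.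
have := hP (delta_mx 0 b); rewrite fE lc_delta => ->.
rewrite /= -rowE (row_sum_delta (row b _)) linear_sum; apply: eq_bigr => c _.
by rewrite linearZ !mxE.
Qed.

Lemma Ext_vanishes_mxim j u : Ext_vanishes j.+1 M R^o ->
  u *m (A j.+1)^T = 0 <-> mxim (A j)^T u.
Proof.
move=> ext; split=> [u0|[v ->]].
  have [c|w wP] := @Ext_vanishes_act R^o j (fun i => u 0 i) ext.
    have /rowP/(_ c) := u0; rewrite !mxE => u0c; rewrite -[RHS]u0c.
    by apply: eq_bigr => i _; rewrite mulrC.
  exists (\row_i w i); apply/rowP => i; rewrite wP !mxE.
  by apply: eq_bigr => k _; rewrite !mxE mulrC.
rewrite -mulmxA -trmx_mul; suff -> : A j.+1 *m A j = 0 by rewrite trmx0 mulmx0.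
by apply/row_matrixP => i; rewrite row_mul row0; apply/Aex/mxim_row.
Qed.

(** A tuple z gives the tensor with terms e_a (x) pi (z a); the bilinear maps (u, y) |-> u_b y
    recover the coordinates of a tensor in X. *)
Lemma Tor_vanishes_exact_at n (V X : lmodType R) (U : set V) (pi : {linear V -> X}) :
  surjective pi -> (forall v, pi v = 0 <-> U v) ->
  Tor_vanishes n.+1 M X -> exact_at A n U setT.
Proof.
move=> pi_surj piU tor z _ Uz.
pose s := [seq (delta_mx 0 a : 'rV[R]_(p n.+1), pi (z a)) | a <- index_enum 'I_(p n.+1)].
have [|t tP] := tor matrix_resolution s.
- move=> C phi; rewrite /tensor_map /s !big_map big_nil /=.
  transitivity (\sum_b phi (delta_mx 0 b) (pi (act (A n) z b))).
    under eq_bigr do rewrite -rowE (row_sum_delta (row _ _)) linear_sumlz.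
    rewrite exchange_big; apply: eq_bigr => b _; rewrite /act !linear_sum.
    by apply: eq_bigr => a _; rewrite linearZl_LR linearZ /= linearZr_LR mxE.
  by apply: big1 => b _; rewrite (piU _).2 // linear0r.
have [r rP] := choice pi_surj.
exists (fun c => \sum_(q <- t) q.1 0 c *: r q.2); split=> // b; apply/piU.
have L1 (y : X) : linear (fun u : 'rV[R]_(p n.+1) => u 0 b *: y).
  by move=> c u v; rewrite !mxE scalerDl scalerA.
have L2 (u : 'rV[R]_(p n.+1)) : linear (fun y : X => u 0 b *: y).
  by move=> c y y'; rewrite scalerDr !scalerA mulrC.
have [phi phiE] := bilinear_of_fun L1 L2.
have := tP X phi; rewrite /tensor_map /s !big_map /=.
rewrite [RHS](bigD1 b) //= phiE mxE !eqxx scale1r [X in _ + X]big1 ?addr0; last first.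
  by move=> a ab; rewrite phiE mxE eq_sym (negPf ab) andbF scale0r.
move=> E; rewrite linearB /= -E linear_act; apply/eqP; rewrite subr_eq0; apply/eqP.
rewrite /act; under [RHS]eq_bigr do rewrite /= linear_sum scaler_sumr.
rewrite exchange_big; apply: eq_bigr => q _; rewrite phiE mxE scaler_suml.
by apply: eq_bigr => c _; rewrite linearZ /= rP scalerA mulrC.
Qed.

End MatrixResolution.

(* When B1 and B0 are the first matrices of a free resolution of M, X = coker B1^T
   is Tr Omega M and the second hypothesis is Ext^1(M, N) = 0. *)
Lemma Tor1_vanishes_transpose (R : comNzRingType) (N X : lmodType R) f0 f1 f2
    (B0 : 'M[R]_(f1, f0)) (B1 : 'M[R]_(f2, f1)) (pi : {linear 'rV[R]_f2 -> X}) :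
  B1 *m B0 = 0 ->
  (forall z : 'I_f1 -> N, (forall c, act B1^T z c = 0) ->
     exists w, forall b, z b = act B0^T w b) ->
  surjective pi -> (forall v, pi v = 0 <-> mxim B1^T v) ->
  Tor_vanishes 1 N X.
Proof.
move=> BB ext pi_surj piU P s cyc.
have [r rP] := choice pi_surj.
(* The quotient of P_0^f2 by [V] is P_0 (x) X; the bilinear map into it turns the cycle condition
   into equations in P_0. *)
pose V := [set h : {ffun 'I_f2 -> P 0%N} |
  exists p : 'I_f1 -> P 0%N, forall j, h j = act B1^T p j].
have sV : submod V.
  split=> [|h h' [q qP] [q' q'P]|c h [q qP]].
  - by exists (fun=> 0) => j; rewrite ffunE /act big1 // => i _; rewrite scaler0.
  - by exists (fun i => q i + q' i) => j; rewrite ffunE actD qP q'P.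
  - exists (fun i => c *: q i) => j; rewrite ffunE qP /act scaler_sumr.
    by apply: eq_bigr => i _; rewrite !scalerA mulrC.
have [Y [piY [_ piYV]]] := quotient_module sV.
have piY_eq h h' : V (h - h') -> piY h = piY h'.
  by move=> /piYV/eqP; rewrite linearB subr_eq0 => /eqP.
pose tens (q : P 0%N) (x : X) : {ffun 'I_f2 -> P 0%N} := [ffun j => r x 0 j *: q].
have L1 x : linear (fun q => piY (tens q x)).
  move=> c q q'; rewrite -linearP; congr (piY _); apply/ffunP => j.
  by rewrite !ffunE scalerDr !scalerA mulrC.
have L2 q : linear (fun x => piY (tens q x)).
  move=> c x x'; rewrite -linearP; apply: piY_eq.
  have /piU[v vE] : pi (r (c *: x + x') - (c *: r x + r x')) = 0.
    by rewrite linearB linearP !rP subrr.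
  exists (fun i => v 0 i *: q) => j; rewrite !ffunE !scalerA -scalerDl -scalerBl.
  have /rowP/(_ j) := vE; rewrite !mxE => ->; rewrite scaler_suml.
  by apply: eq_bigr => i _; rewrite scalerA mulrC.
have [phi phiE] := bilinear_of_fun L1 L2.
have [p' p'P] : exists p' : 'I_f1 -> P 0%N, forall j,
    \sum_(q <- s) r q.2 0 j *: res_diff P 0 q.1 = act B1^T p' j.
  have := cyc Y phi; rewrite /tensor_map big_map big_nil.
  under eq_bigr do rewrite phiE; rewrite -linear_sum => /piYV[p' p'P].
  by exists p' => j; rewrite -p'P sum_ffunE; apply: eq_bigr => q _; rewrite ffunE.
have augd y : res_aug P (res_diff P 0 y) = 0 by apply/res_exact0; exists y.
(* The augmentation kills the boundaries in [p'P], so the Ext hypothesis applies to the image of p'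
   in N. Lifting w to q in P_0 leaves p' - B0^T q in the image of P_1. *)
have [j|w wP] := ext (res_aug P \o p').
  rewrite -linear_act -p'P linear_sum big1 // => q _.
  by rewrite linearZ /= augd scaler0.
have [q qP] := choice (fun l => res_aug_surj P (w l)).
have ker i : exists h, res_diff P 0 h = p' i - act B0^T q i.
  apply/res_exact0; rewrite linearB linear_act /=; apply/eqP; rewrite subr_eq0; apply/eqP.
  by rewrite [LHS]wP; apply: eq_act => l; rewrite /= qP.
have [h hP] := choice ker.
(* Subtracting B1^T h makes the coordinates of s into cycles, as B1^T B0^T = 0, and does not change
   the tensor in P_1 (x) X. *)
pose e j := \sum_(y <- s) r y.2 0 j *: y.1 - act B1^T h j.
have ebd j : exists t, res_diff P 1 t = e j.
  apply/res_exact; rewrite linearB linear_act linear_sum /=.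
  have -> : \sum_(y <- s) res_diff P 0 (r y.2 0 j *: y.1) = act B1^T p' j.
    by rewrite -p'P; apply: eq_bigr => y _; rewrite linearZ.
  have -> : act B1^T (res_diff P 0 \o h) j = act B1^T p' j - act B1^T (act B0^T q) j.
    by rewrite -actB; apply: eq_act.
  by rewrite subKr act_comp -trmx_mul BB trmx0 act0.
have [t tP] := choice ebd.
exists [seq (t j, pi (delta_mx 0 j)) | j <- index_enum 'I_f2] => C psi.
rewrite /tensor_map !big_map /=.
have psiE y (x : 'rV[R]_f2) : \sum_j x 0 j *: psi y (pi (delta_mx 0 j)) = psi y (pi x).
  rewrite [in RHS](row_sum_delta x) !linear_sum; apply: eq_bigr => j _.
  by rewrite linearZ /= linearZr_LR.
transitivity (\sum_j \sum_(y <- s) r y.2 0 j *: psi y.1 (pi (delta_mx 0 j)) -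
    \sum_j \sum_i B1^T i j *: psi (h i) (pi (delta_mx 0 j))).
  rewrite -sumrB; apply: eq_bigr => j _; rewrite tP linearBl /act !linear_sumlz.
  by congr (_ - _); apply: eq_bigr => i _; rewrite linearZl_LR.
rewrite exchange_big [X in _ - X]exchange_big /= [X in _ - X]big1 ?subr0 => [|i _].
  by apply: eq_bigr => y _; rewrite psiE rP.
have rE j : row i B1^T 0 j = B1^T i j by rewrite mxE.
under eq_bigr do rewrite -rE.
by rewrite psiE (piU _).2 ?linear0r //; apply: mxim_row.
Qed.

(** * Regular sequences, fiber products, depth and freeness in the terms used above *)

Lemma seq_smul_take (R : comNzRingType) (M : lmodType R) (s : seq R) i (u : M) :
  (i <= size s)%N ->
  seq_smul M (take i s) u <-> reg_smul (nth 0 s) (setT : set M) i u.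
Proof.
move=> si; rewrite (reg_smul_sum (nth 0 s) i u (I : setT 0)) /seq_smul /= size_takel //.
have E (v : nat -> M) : \sum_(j < i) (take i s)`_j *: v j = \sum_(j < i) s`_j *: v j.
  by apply: eq_bigr => j _; rewrite nth_take.
by split=> [[v ->]|[v [_ ->]]]; exists v; rewrite E.
Qed.

Lemma regular_sequence_upto (R : comNzRingType) (s : seq R) :
  regular_sequence R^o s -> regular_upto (nth 0 s) (setT : set R^o) (size s).
Proof.
case=> regs _ k ks u _ Iu; apply/(seq_smul_take (M := R^o) _ (ltnW ks)).
by apply: regs => //; apply/(seq_smul_take (M := R^o) _ (ltnW ks)).
Qed.

Lemma regular_sequence_rcons (R : comNzRingType) (m : set R) (s : seq R) y :
  ideal m -> ~ m 1 -> (forall r, r \in s -> m r) -> m y ->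
  regular_sequence R^o s ->
  (forall u, reg_smul (nth 0 s) (setT : set R^o) (size s) (y * u) ->
     reg_smul (nth 0 s) (setT : set R^o) (size s) u) ->
  regular_sequence R^o (rcons s y).
Proof.
move=> idm nm1 ms my [regs _] regy; split=> [i|].
  rewrite size_rcons ltnS leq_eqVlt => /predU1P[->|ilt] u.
    rewrite nth_rcons ltnn eqxx -cats1 take_size_cat // => H.
    have sE v : seq_smul R^o s v <-> reg_smul (nth 0 s) (setT : set R^o) (size s) v.
      by rewrite -{1}(take_size s); apply: (seq_smul_take (M := R^o) _ (leqnn _)).
    by apply/sE/regy/sE.
  rewrite nth_rcons ilt -cats1 takel_cat; last exact: ltnW.
  exact: regs.
exists 1 => -[v one]; apply: nm1; rewrite one; apply: (submod_sum (M := R^o)) => // i _.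
rewrite /GRing.scale /= mulrC; case: idm => _ _; apply.
have : (rcons s y)`_i \in rcons s y by apply: mem_nth.
by rewrite mem_rcons inE => /predU1P[->|/ms].
Qed.

Lemma quasi_fiber_split (R : comNzRingType) (m : set R) :
  noetherian_local m -> quasi_fiber_product_ring R ->
  exists s : seq R, [/\ regular_sequence R^o s, forall r, r \in s -> m r
    & exists I J, quasi_split m (reg_smul (nth 0 s) (setT : set R^o) (size s)) I J].
Proof.
move=> hR [s [regs [Q [q [q_surj q_ker]]]]].
move=> [S [T [mS [mT [k [pS [pT [f [_ [resS resT] [ninjS ninjT] f_inj fP]]]]]]]]].
pose a := reg_smul (nth 0 s) (setT : set R^o) (size s).
have aE r : a r <-> f (q r) = 0.
  rewrite -(rmorph0 f); split=> [ar|/f_inj qr].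
    congr (f _); apply/q_ker; rewrite -(take_size s).
    exact/(seq_smul_take (M := R^o) _ (leqnn _)).
  apply/(seq_smul_take (M := R^o) _ (leqnn _)); rewrite take_size.
  exact/q_ker.
pose fst r := (f (q r)).1; pose snd r := (f (q r)).2.
have fq r : f (q r) = (fst r, snd r) by rewrite /fst /snd; case: (f (q r)).
have eq_res r : pS (fst r) = pT (snd r) by apply/fP; exists (q r).
have lift sS t : pS sS = pT t -> exists r, fst r = sS /\ snd r = t.
  move=> /fP[z fz]; have [r rz] := q_surj z; exists r.
  by rewrite /fst /snd rz fz.
have fstD r r' : fst (r + r') = fst r + fst r' by rewrite /fst !rmorphD.
have sndD r r' : snd (r + r') = snd r + snd r' by rewrite /snd !rmorphD.
have fstM r r' : fst (r * r') = fst r * fst r' by rewrite /fst !rmorphM.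
have sndM r r' : snd (r * r') = snd r * snd r' by rewrite /snd !rmorphM.
have fstN r : fst (- r) = - fst r by rewrite /fst !rmorphN.
have fst0 : fst 0 = 0 by rewrite /fst !rmorph0.
have snd0 : snd 0 = 0 by rewrite /snd !rmorph0.
have fst1 : fst 1 = 1 by rewrite /fst !rmorph1.
(* The kernel of R -> k. It is maximal, hence equal to m: a nonzero residue is inverted by lifting
   its inverse to S and T and then to R. *)
pose m' := [set r | pS (fst r) = 0].
have idm' : ideal m'.
  split=> [|r r' mr mr'|c r mr]; rewrite /m' /=.
  - by rewrite fst0 rmorph0.
  - by rewrite fstD rmorphD mr mr' addr0.
  - by rewrite fstM rmorphM mr mulr0.
have m'E : m' = m.
  case: (hR) => _ _; apply; split=> // [|K idK nK1 m'K r Kr].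
    by rewrite /m' /= fst1 rmorph1 => /eqP; rewrite oner_eq0.
  apply: contrapT => nr; apply: nK1.
  have [sS sSE] := resS.1 (pS (fst r))^-1.
  have [t tE] := resT.1 (pS (fst r))^-1.
  have [|b [b1 b2]] := lift sS t; first by rewrite sSE tE.
  apply: (submod_addr (M := R^o) idK (y := - (b * r))).
    by apply: (submodN (M := R^o)) => //; case: idK => _ _; apply.
  apply: m'K; rewrite /m' /= fstD fstN fstM fst1 b1 rmorphB rmorphM rmorph1 sSE.
  by rewrite mulVf ?subrr //; apply/eqP.
exists s.
(* The kernels of R -> T and R -> S. *)
pose I := [set r | snd r = 0]; pose J := [set r | fst r = 0].
have idI : ideal I.
  split=> [//|r r' Ir Ir'|c r Ir]; rewrite /I /=.
    by rewrite sndD Ir Ir' addr0.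
  by rewrite sndM Ir mulr0.
have idJ : ideal J.
  split=> [//|r r' Ir Ir'|c r Ir]; rewrite /J /=.
    by rewrite fstD Ir Ir' addr0.
  by rewrite fstM Ir mulr0.
have spl : quasi_split m a I J.
  rewrite -m'E; split=> //.
  - exact: reg_smul_ideal.
  - by move=> r /aE; rewrite fq => -[].
  - by move=> r /aE; rewrite fq => -[].
  - by move=> r [Ir Jr]; apply/aE; rewrite fq Ir Jr.
  - by move=> r Ir; rewrite /m' /= eq_res Ir rmorph0.
  - by move=> r Jr; rewrite /m' /= Jr rmorph0.
  - move=> r mr; have [|r' [r'1 r'2]] := lift (fst r) 0; first by rewrite mr rmorph0.
    exists r', (r - r'); split=> //; last by rewrite addrC subrK.
    by rewrite /J /= fstD fstN r'1 subrr.
  (* For u, v with the same residue, the pair (u - v, 0) lifts to an element of [I]; if that is in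
     a, then u = v. *)
  - move=> Ia; apply: ninjS => u v uv; apply/eqP; rewrite -subr_eq0; apply/eqP.
    have [|r [r1 r2]] := lift (u - v) 0; first by rewrite rmorphB uv subrr rmorph0.
    by have /aE := Ia r r2; rewrite fq r1 => -[].
  - move=> Ja; apply: ninjT => u v uv; apply/eqP; rewrite -subr_eq0; apply/eqP.
    have [|r [r1 r2]] := lift 0 (u - v); first by rewrite rmorphB uv subrr rmorph0.
    by have /aE := Ja r r1; rewrite fq r2 => -[].
split=> //; last by exists I, J.
move=> r rs; apply: (split_maxl spl); apply: (split_subl spl).
rewrite /a -(nth_index 0 rs); have : seq_smul R^o s s`_(index r s).
  by apply: seq_smul_nth; rewrite index_mem.
by rewrite -{1}(take_size s) => /(seq_smul_take (M := R^o) _ (leqnn _)).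
Qed.

Lemma depth_is_depth (R : comNzRingType) (m : set R) (M : lmodType R) (s0 : seq R) b :
  regular_sequence M s0 -> (forall r, r \in s0 -> m r) ->
  (forall s, regular_sequence M s -> (forall r, r \in s -> m r) -> (size s <= b)%N) ->
  is_depth m M (depth m M).
Proof.
move=> reg0 m0 bound; apply: xgetPex.
pose P d := `[< exists s, [/\ regular_sequence M s, forall r, r \in s -> m r & size s = d] >].
have exP : exists d, P d by exists (size s0); apply/asboolP; exists s0.
have leP d : P d -> (d <= b)%N by move=> /asboolP[s [? ? <-]]; apply: bound.
case: (ex_maxnP exP leP) => d /asboolP Pd max; exists d; split=> // s regs ms.
by apply: max; apply/asboolP; exists s.
Qed.

Lemma module_resolution (R : comNzRingType) (m : set R) (M : lmodType R) :
  noetherian_local m -> finitely_generated M ->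
  exists (p : nat -> nat) (A : forall i, 'M[R]_(p i.+1, p i)) (g : 'I_(p 0%N) -> M),
  [/\ surjective (lc g), forall u, lc g u = 0 <-> mxim (A 0%N) u,
      forall i u, u *m A i = 0 <-> mxim (A i.+1) u & forall i b c, m (A i b c)].
Proof.
move=> hR [s sP].
have [|//|v _|b [g [_ genM ming]]] :=
    @minimal_generators _ _ hR M [set 0] setT (size s) (fun i => s`_i).
- exact: submod0.
- have [c ->] := sP v; exists (\row_i c i); apply/eqP; rewrite subr_eq0; apply/eqP.
  by apply: eq_bigr => i _; rewrite mxE.
have sK := submod_preim (lc g) (submod0 M).
have [q [A0 [A [A0P A00 Aex mA]]]] := minimal_resolution hR sK.
exists (cons_dim b q), (cons_mx A0 A), g; split=> //.
- move=> v; have [c /eqP] := genM v I.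
  by rewrite subr_eq0 => /eqP ->; exists c.
- by case=> [|i] u; [apply: A00|apply: Aex].
- case=> [|i] c d; last exact: mA.
  have /A0P/ming/(_ d) : mxim A0 (row c A0) by apply: mxim_row.
  by rewrite mxE.
Qed.

Lemma free_of_lc (R : comNzRingType) (M : lmodType R) n (g : 'I_n -> M) :
  surjective (lc g) -> (forall u, lc g u = 0 -> u = 0) -> free_module M.
Proof.
move=> g_surj g_inj; have [f fE] := linear_of_fun (lc_is_linear g).
have [h hP] := choice g_surj; exists n, f; exists h => u; last by rewrite fE hP.
apply/eqP; rewrite -subr_eq0; apply/eqP/g_inj.
by rewrite linearB /= hP fE subrr.
Qed.

Theorem corollary3p15 (R : comNzRingType) (m : set R) (M N : lmodType R)
  (hR : noetherian_local m)
  (hqfp : quasi_fiber_product_ring R)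
  (hMfg : finitely_generated M) (hM0 : exists u : M, u <> 0)
  (hNfg : finitely_generated N) (hN0 : exists u : N, u <> 0)
  (hpd : pd_infinite N)
  (hTor : Tor_rigid N)
  (hExtN : forall i : nat,
     (1 <= i <= maxn 1 (depth m N - 2))%N -> Ext_vanishes i M N)
  (hExtR : forall j : nat,
     (1 <= j <= depth m R^o)%N -> Ext_vanishes j M R^o) :
  free_module M.
Proof.
have [s [regs ms [I [J spl]]]] := quasi_fiber_split hR hqfp.
have regR := regular_sequence_upto regs.
have xm i : (i < size s)%N -> m s`_i by move=> si; apply: ms; apply: mem_nth.
have idm := local_ideal hR.
(* Tor against N is computed from a minimal resolution (p, A) of N. *)
have [p [A [gN [gN_surj gN_ker Aex mA]]]] := module_resolution hR hNfg.
have AA i : A i.+1 *m A i = 0.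
  by apply/row_matrixP => b; rewrite row_mul row0; apply/Aex/mxim_row.
have torR : tor_small A ([set 0] : set R^o) setT.
  by exists 0%N => i _; apply: exact_at_free => u /Aex.
have ntork : ~ tor_small A (m : set R^o) setT.
  move=> /(residue_tor_small_finite hR mA)[i0 p0]; apply: (hpd i0).
  exact: (pd_le_matrix gN_surj gN_ker Aex).
(* The bound on regular sequences ensures that the maximum exists, so [depth] is not the default
   value 0 by accident. *)
have dep : is_depth m R^o (depth m R^o).
  apply: (depth_is_depth (b := (size s).+1) regs ms) => y regy my.
  apply: (regular_length_bound hR xm regR spl AA torR ntork _ (regular_sequence_upto regy)).
  by move=> i iy; apply: my; apply: mem_nth.
set d := depth m R^o in hExtR dep.
have sd : (size s <= d)%N by apply: dep.2.
have ds : (d <= (size s).+1)%N.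
  case: dep.1 => y [regy my <-].
  apply: (regular_length_bound hR xm regR spl AA torR ntork _ (regular_sequence_upto regy)).
  by move=> i iy; apply: my; apply: mem_nth.
(* A regular element modulo s would extend s to a regular sequence of length d + 1. *)
have socle : d = size s -> exists z,
    ~ reg_smul (nth 0 s) (setT : set R^o) (size s) z /\
    forall r, m r -> reg_smul (nth 0 s) (setT : set R^o) (size s) (r * z).
  move=> dE; have [[y [my regy]]|//] := regular_or_socle (local_noetherian hR) idm
      (reg_smul_ideal (nth 0 s) (size s)).
  have : (size (rcons s y) <= d)%N.
    apply: dep.2; first exact: (regular_sequence_rcons idm (local_not1 hR) ms my regs regy).
    by move=> r; rewrite mem_rcons inE => /predU1P[->|/ms].
  by rewrite size_rcons dE ltnn.
(* The dual of a minimal resolution (F, B) of M has matrices (B j)^T. *)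
have [F [B [gM [gM_surj gM_ker Bex mB]]]] := module_resolution hR hMfg.
have mBT j b c : m ((B j)^T b c) by rewrite mxE.
suff B00 : B 0%N = 0.
  by apply: (free_of_lc gM_surj) => u /gM_ker[v ->]; rewrite B00 mulmx0.
have BB i : B i.+1 *m B i = 0.
  by apply/row_matrixP => b; rewrite row_mul row0; apply/Bex/mxim_row.
have [X [pi [pi_surj piU]]] := quotient_module (mxim_submod (B 1%N)^T).
have Xfg : finitely_generated X.
  pose G := [seq pi (delta_mx 0 j) | j <- enum 'I_(F 2%N)].
  exists G => x; have [r <-] := pi_surj x.
  pose c k := if insub k is Some j then r 0 (j : 'I_(F 2%N)) else 0.
  exists c; rewrite -(big_mkord xpredT (fun k => c k *: G`_k)) size_map size_enum_ord.
  rewrite big_mkord {1}(row_sum_delta r) linear_sum; apply: eq_bigr => j _.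
  rewrite linearZ /= (nth_map j) ?size_enum_ord // nth_ord_enum /c insubT // => lt_j.
  by congr (r 0 _ *: _); apply: val_inj.
(* Ext^1(M, N) = 0 gives the first Tor, and rigidity gives all others. *)
have TorX n : Tor_vanishes n.+1 N X.
  elim: n => [|n IHn]; last exact: hTor IHn.
  apply: (Tor1_vanishes_transpose (BB 0%N) _ pi_surj piU) => z.
  apply: (Ext_vanishes_act gM_surj gM_ker Bex).
  by apply: hExtN; rewrite leq_maxl.
have TX : tor_small A (mxim (B 1%N)^T) setT.
  exists 0%N => n _.
  exact: (Tor_vanishes_exact_at gN_surj gN_ker Aex pi_surj piU (TorX n)).
have dualex j u : (j < d)%N -> u *m (B j.+1)^T = 0 <-> mxim (B j)^T u.
  by move=> jd; apply: (Ext_vanishes_mxim gM_surj gM_ker Bex); apply: hExtR.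
have trmx0P q r (D : 'M[R]_(q, r)) : D^T = 0 -> D = 0.
  by move=> D0; rewrite -[D]trmxK D0 trmx0.
apply/trmx0P.
(* For d = 0 the sequence s is empty and z is a socle element of R itself. The cokernel of (B 1)^T
   is small, so B 1 = 0 and B 0 is injective on rows; but its entries lie in m, so it kills z e_b
   for every index b. *)
have [d0|dpos] := posnP d.
  have s0 : size s = 0%N by apply/eqP; rewrite -leqn0 -d0.
  have [z [naz mz]] : exists z, ~ reg_smul (nth 0 s) (setT : set R^o) (size s) z /\
      forall r, m r -> reg_smul (nth 0 s) (setT : set R^o) (size s) (r * z).
    by apply: socle; rewrite d0.
  have B1 : B 1%N = 0.
    apply/trmx0P.
    apply: (socle_syzygy_eq0 hR xm regR spl AA torR ntork (mBT 1%N) _ naz mz).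
    by rewrite s0; apply: syzygy_like0.
  apply/trmx_inj; rewrite trmxK trmx0; apply/row_matrixP => b.
  have : (z *: delta_mx 0 b : 'rV_(F 1%N)) *m B 0%N = 0.
    apply/rowP => c; rewrite -scalemxAl -rowE !mxE mulrC.
    by move: (mz _ (mB 0%N b c)); rewrite s0.
  move=> /Bex[v]; rewrite B1 mulmx0 => /rowP/(_ b); rewrite !mxE !eqxx mulr1 => z0.
  by case: naz; rewrite s0.
(* The image of (B (j+2))^T is isomorphic to the cokernel of (B (j+1))^T, so smallness passes to the
   next cokernel. *)
have TC j : (j < d)%N -> tor_small A (mxim (B j.+1)^T) setT.
  elim: j => [//|j IHj] jd.
  apply: (tor_small_quot AA (submod0 _) (mxim_submod _) (@submodT _ _)) => //.
  - by move=> _ ->; case: (mxim_submod (B j.+2)^T).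
  - have [i0 i0P] := IHj (ltnW jd); exists i0 => i /i0P.
    by move/(exact_at_mxim _ _ (fun u => dualex j.+1 u jd)).
  - exact: tor_small_rV.
(* In the dual complex (B j)^T gives the relations of (B (j+1))^T; starting at j = d, each step down
   gains one degree. *)
have syn k j : (k + j)%N = d -> syzygy_like (nth 0 s) A (size s) k (B j)^T.
  elim: k j => [|k IHk] j kj.
    case: j kj => [kj|j kj]; first by move: dpos; rewrite -kj.
    by apply: syzygy_like0 => //; apply: TC; rewrite -kj.
  apply: (syzygy_like_step AA regR torR) (IHk j.+1 _); last by rewrite addnS.
  by move=> u; apply: dualex; rewrite -kj ltnS leq_addl.
(* If d = n, the length of s, then (B 0)^T is [syzygy_like] of level n and a socle element exists.
   If d = n + 1, then (B 1)^T has level n and (B 0)^T is its next syzygy. *)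
have [dE|] := eqVneq d (size s).
  have [z [naz mz]] := socle dE.
  apply: (socle_syzygy_eq0 hR xm regR spl AA torR ntork (mBT 0%N) _ naz mz).
  by apply: syn; rewrite addn0.
rewrite eqn_leq sd andbT -ltnNge => sd'.
have dE : d = (size s).+1 by apply/eqP; rewrite eqn_leq ds.
apply: (next_syzygy_eq0 hR xm regR spl AA torR ntork (mBT 1%N) _ (mBT 0%N)).
  by apply: syn; rewrite dE addn1.
by move=> u; apply: dualex.
Qed.
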